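(* Let $\sigma_i$ ($i=0,1,2,3$) be the fermionic screening operators and $\rho_j,\tau_j$ ($j=1,2,3$) the bosonic screening operators defined in the context, and write $[A,B]=AB-BA$, $[A,B]_+=AB+BA$. Then $$[\sigma_i,\rho_j]_+=[\sigma_i,\tau_j]_+=0\qquad (i=0,1,2,3,\ j=1,2,3),$$ $$[\rho_i,\rho_j]=[\rho_i,\tau_j]=[\tau_i,\tau_j]=0\qquad (i,j=1,2,3,\ i\neq j),$$ on each sector $\mathcal H_\beta$ on which the left hand sides are defined.
   Context: Fix $q\in\mathbb C^\times$ with $|q|<1$ (and a choice of $\log q$, $q^x=e^{x\log q}$), and put $[x]=(q^x-q^{-x})/(q-q^{-1})$. Fix generic $k_1,k_2,k_3\in\mathbb C$ with $k_1+k_2+k_3=-4$. Free fields. Consider $a_i(z)=Q_{a_i}+a_{i,0}\log z-\sum_{n\neq0}\frac{a_{i,n}}{n}z^{-n}$, $i=0,1,2,3$. The oscillators $a_{i,n}$ ($n\ne0$, $0\le i\le 3$) are independent; the zero modes satisfy $\sum_{i=0}^3a_{i,0}=0$, $\sum_{i=0}^3Q_{a_i}=0$. For $n\neq 0$ the commutation relations are $[a_{i,n},a_{i,-n}]=n$, $[a_{i,0},Q_{a_i}]=1$ for $0\le i\le3$; $[a_{0,n},a_{i,-n}]=n\frac{[(k_i+1)n]}{[n]}$, $[a_{0,0},Q_{a_i}]=[a_{i,0},Q_{a_0}]=k_i+1$ for $i=1,2,3$; $[a_{i,n},a_{j,-n}]=n\frac{[(k_l+1)n]}{[n]}$, $[a_{i,0},Q_{a_j}]=k_l+1$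 for $\{i,j,l\}=\{1,2,3\}$; all other commutators vanish. Fock space: $\mathcal H=\bigoplus_\beta\mathcal H_\beta$, $\mathcal H_\beta=\mathbb C[a_{i,-n}\mid n>0,\ i=0,1,2,3]\otimes\mathbb C e^\beta$ (the ''sector'' of momentum $\beta$), with $\beta$ in the three-dimensional space $\bigoplus_{i=1}^3\mathbb C Q_{a_i}$; $a_{i,n}$ ($n>0$) kills $e^\beta$, $a_{i,0}$ acts on $\mathcal H_\beta$ by the scalar $[a_{i,0},\beta]$, and $e^{Q}$ sends $e^\beta$ to $e^{\beta+Q}$. Normal ordering $:\ :$ puts $Q_{a_i}$ and $a_{i,n}$ ($n<0$) to the left of $a_{i,n}$ ($n\ge0$). For $N\in\mathbb C$ put $a_i(N;z)=\frac1N(Q_{a_i}+a_{i,0}\log z)-\sum_{n\ne0}\frac{[n]}{[Nn]}\frac{a_{i,n}}{n}z^{-n}$. Screening currents. $\sigma_i(z)=:e^{a_i(z)}:$ for $i=0,1,2,3$. For $(i,j,l)$ a cyclic permutation of $(1,2,3)$, $$r_i^\pm(z)=-a_j(k_i+2;z)-a_l(k_i+2;q^{\mp(k_i+2)}z),\qquad t_i^\pm(z)=-a_0(k_i+2;z)-a_i(k_i+2;q^{\mp(k_i+2)}z),$$ $$\rho_i(z)=\frac{1}{(q-q^{-1})z}\bigl(:e^{r_i^+(z)}:-:e^{r_i^-(z)}:\bigr),\qquad \tau_i(z)=\frac{1}{(q-q^{-1})z}\bigl(:e^{t_i^+(z)}:-:e^{t_i^-(z)}:\bigr).$$ Screening operators: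 $\sigma_i=\int\sigma_i(z)dz$, $\rho_j=\int\rho_j(z)dz$, $\tau_j=\int\tau_j(z)dz$, where $\int dz$ denotes integration over a closed contour around $0$ (i.e., up to normalization, the coefficient of $z^{-1}$). On $\mathcal H_\beta$ the operator $\sigma_i$ is well-defined if $[a_{i,0},\beta]\in\mathbb Z$, and $\rho_i,\tau_i$ are well-defined if $[a_{j,0}+a_{l,0},\beta]\in(k_i+2)\mathbb Z$ for $\{i,j,l\}=\{1,2,3\}$. *)

(* Defs.v *)
From mathcomp Require Import all_boot all_order all_algebra finmap.
From mathcomp Require Import boolp classical_sets fsbigop reals sequences exp trigo.
From mathcomp Require Import complex monalg.
Set Implicit Arguments.
Unset Strict Implicit.
Unset Printing Implicit Defensive.
Import Order.TTheory GRing.Theory Num.Theory.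
Local Open Scope ring_scope.
Local Open Scope complex_scope.
Local Open Scope classical_set_scope.

Definition cexp (R : realType) (z : R[i]) : R[i] :=
  let: a +i* b := z in (expR a * cos b) +i* (expR a * sin b).

(* The number q enters only through the chosen value lq of log q. *)
Definition qpow (R : realType) (lq x : R[i]) : R[i] := cexp (x * lq).

Definition qnum (R : realType) (lq x : R[i]) : R[i] :=
  (qpow lq x - qpow lq (- x)) / (qpow lq 1 - qpow lq (- 1)).

(* The bosons a_0, a_1, a_2, a_3 are indexed by 'I_4; the labels 1, 2, 3 of   *)
(* k, rho and tau are indexed by 'I_3 = Z/3 via i |-> i + 1, so that          *)
(* [bos i] is the label in 'I_4 of i : 'I_3, the cyclic permutations of       *)
(* (1,2,3) are the triples (i, i + 1, i + 2), and for i != j the remaining    *)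
(* label is - (i + j), because 0 + 1 + 2 = 0 in Z/3.                          *)
Definition bos (i : 'I_3) : 'I_4 := lift ord0 i.

(* The only denominators in the definitions below that depend on k are        *)
(* k_i + 2 and [(k_i + 2) n] with n <> 0 (and [- x] = - [x]).                 *)
Definition generic (R : realType) (lq : R[i]) (k : 'I_3 -> R[i]) : Prop :=
  forall i, k i + 2%:R != 0 /\
    forall n : nat, (0 < n)%N -> qnum lq ((k i + 2%:R) * n%:R) != 0.

(* The number c_ij for which [a_{i,n}, a_{j,-n}] = n [c_ij n] / [n] and       *)
(* [a_{i,0}, Q_{a_j}] = c_ij; on the diagonal c_ii = 1 gives n [n] / [n] = n. *)
Definition cpl (R : realType) (k : 'I_3 -> R[i]) (i j : 'I_4) : R[i] :=
  match unlift ord0 i, unlift ord0 j with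
  | None, None => 1
  | None, Some j' => k j' + 1
  | Some i', None => k i' + 1
  | Some i', Some j' => if i' == j' then 1 else k (- (i' + j')) + 1
  end.

(* Polynomials in the creation operators; the variable (i, n) is a_{i,-(n+1)}. *)
Definition Fock (R : realType) := {malg R[i][{cmonom ('I_4 * nat)%type}]}.

(* Coordinates in the basis Q_{a_1}, Q_{a_2}, Q_{a_3}. *)
Definition momentum (R : realType) := 'rV[R[i]]_3.

(* The direct sum of the sectors Fock (x) C e^b; << p *g b >> is p (x) e^b. *)
Definition fockH (R : realType) := {malg (Fock R)[momentum R]}.

Definition sector (R : realType) (b : momentum R) (v : fockH R) : Prop :=
  exists p : Fock R, v = << p *g b >>.

(* The momentum Q_{a_i}, with Q_{a_0} = - Q_{a_1} - Q_{a_2} - Q_{a_3}. *)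
Definition Qmom (R : realType) (i : 'I_4) : momentum R :=
  if unlift ord0 i is Some j then delta_mx ord0 j else - const_mx 1.

(* The scalar [a_{i,0}, b] by which a_{i,0} acts on the sector b. *)
Definition zeromode (R : realType) (k : 'I_3 -> R[i]) (i : 'I_4)
    (b : momentum R) : R[i] :=
  \sum_(j < 3) b ord0 j * cpl k i (bos j).

Definition pder (R : realType) (x : ('I_4 * nat)%type) (p : Fock R) : Fock R :=
  \sum_(m <- msupp p) << p@_m *+ m x *g divcm m (ucm x) >>.

(* a_{i,n} for n <> 0 (the value at n = 0 is 0 and is not used). *)
Definition mode (R : realType) (lq : R[i]) (k : 'I_3 -> R[i]) (i : 'I_4)
    (n : int) (p : Fock R) : Fock R :=
  match n with
  | Posz m => \sum_(j < 4)
      (m%:R * qnum lq (cpl k i j * m%:R) / qnum lq m%:R) *: pder (j, m.-1) p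
  | Negz m => << ucm (i, m) >> * p
  end.

(* The data of a field                                                        *)
(*   X(z) = sum_i (fQ i Q_{a_i} + flog i a_{i,0} log z + fcst i a_{i,0}       *)
(*                 + sum_(n <> 0) fosc i n a_{i,n} z^(-n)).                   *)
Record field (R : realType) := Field {
  fQ : 'I_4 -> R[i];
  flog : 'I_4 -> R[i];
  fcst : 'I_4 -> R[i];
  fosc : 'I_4 -> int -> R[i] }.

Definition fieldN (R : realType) (X : field R) : field R :=
  Field (fun i => - fQ X i) (fun i => - flog X i) (fun i => - fcst X i)
    (fun i n => - fosc X i n).

Definition fieldD (R : realType) (X Y : field R) : field R :=
  Field (fun i => fQ X i + fQ Y i) (fun i => flog X i + flog Y i)
    (fun i => fcst X i + fcst Y i) (fun i n => fosc X i n + fosc Y i n).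

(* a_i(z) *)
Definition boson (R : realType) (i : 'I_4) : field R :=
  Field (fun j => (j == i)%:R) (fun j => (j == i)%:R) (fun=> 0)
    (fun j n => if j == i then - n%:~R^-1 else 0).

(* a_i(N; q^s z), where log (q^s z) = log z + s log q *)
Definition bosonN (R : realType) (lq : R[i]) (i : 'I_4) (N s : R[i]) :
    field R :=
  Field (fun j => (j == i)%:R / N) (fun j => (j == i)%:R / N)
    (fun j => (j == i)%:R / N * (s * lq))
    (fun j n => if j == i then
       - (qnum lq n%:~R / qnum lq (N * n%:~R) / n%:~R
          * qpow lq (- s * n%:~R)) else 0).

Definition field_mom (R : realType) (X : field R) : momentum R :=
  \sum_(i < 4) fQ X i *: Qmom R i.

Definition field_mode (R : realType) (lq : R[i]) (k : 'I_3 -> R[i])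
    (X : field R) (n : int) (p : Fock R) : Fock R :=
  \sum_(i < 4) fosc X i n *: mode lq k i n p.

(* [ops_mul x f] is the product of the operator-valued series                 *)
(* sum_(n >= 1) x_n t^n with the Fock-valued series sum_m f_m t^m.            *)
Definition ops_mul (R : realType) (x : nat -> Fock R -> Fock R)
    (f : nat -> Fock R) (m : nat) : Fock R :=
  \sum_(1 <= n < m.+1) x n (f (m - n)%N).

(* Coefficient of t^m in exp (sum_(n >= 1) x_n t^n) p; the r-th power of the  *)
(* exponent has no terms of degree < r, so only r <= m contribute.            *)
Definition exp_coef (R : realType) (x : nat -> Fock R -> Fock R)
    (p : Fock R) (m : nat) : Fock R :=
  \sum_(r < m.+1)
    (r`!%:R)^-1 *: iter r (ops_mul x) (fun d => if d is 0%N then p else 0) m.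

(* The coefficient of z^s (s complex) in :e^{X(z)}:, as the map Fock -> Fock  *)
(* from the sector b to the sector b + field_mom X. On the sector b, with     *)
(* h = sum_i flog i [a_{i,0}, b], this is the coefficient of z^s in           *)
(*   z^h e^{sum_i fcst i [a_{i,0}, b]} exp (sum_(n>0) X_{-n} z^n)             *)
(*                                     exp (sum_(n>0) X_n z^{-n}).            *)
(* For fixed p only finitely many d.1 give a nonzero annihilation factor, so  *)
(* the sum has finite support.                                                *)
Definition normexp (R : realType) (lq : R[i]) (k : 'I_3 -> R[i])
    (X : field R) (b : momentum R) (s : R[i]) (p : Fock R) : Fock R :=
  cexp (\sum_(i < 4) fcst X i * zeromode k i b) *:
  \sum_(d \in [set d : nat * nat |
      \sum_(i < 4) flog X i * zeromode k i b + d.2%:R - d.1%:R = s])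
    exp_coef (fun n => field_mode lq k X (- n%:Z))
      (exp_coef (fun n => field_mode lq k X n%:Z) p d.1) d.2.

(* A partially defined operator on fockH that maps the sector b to the sector *)
(* b + op_mom; op_dom lists the sectors on which it is well-defined.          *)
Record operator (R : realType) := Operator {
  op_mom : momentum R;
  op_dom : momentum R -> Prop;
  op_act : momentum R -> Fock R -> Fock R }.

Definition op_app (R : realType) (A : operator R) (v : fockH R) : fockH R :=
  \sum_(b <- msupp v) << op_act A b v@_b *g b + op_mom A >>.

Definition sigma (R : realType) (lq : R[i]) (k : 'I_3 -> R[i]) (i : 'I_4) :
    operator R :=
  Operator (field_mom (boson R i))
    (fun b => exists m : int, zeromode k i b = m%:~R)
    (fun b => normexp lq k (boson R i) b (- 1)).

(* r_i^+ and r_i^- for e = 1 and e = -1, and likewise for t_i *)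
Definition rfield (R : realType) (lq : R[i]) (k : 'I_3 -> R[i]) (i : 'I_3)
    (e : R[i]) : field R :=
  let N := k i + 2%:R in
  fieldD (fieldN (bosonN lq (bos (i + 1)) N 0))
         (fieldN (bosonN lq (bos (i + 2%:R)) N (- e * N))).

Definition tfield (R : realType) (lq : R[i]) (k : 'I_3 -> R[i]) (i : 'I_3)
    (e : R[i]) : field R :=
  let N := k i + 2%:R in
  fieldD (fieldN (bosonN lq ord0 N 0)) (fieldN (bosonN lq (bos i) N (- e * N))).

(* Coefficient of z^s in (:e^{X(z)}: - :e^{Y(z)}:) / ((q - q^-1) z). *)
Definition qdiff (R : realType) (lq : R[i]) (k : 'I_3 -> R[i])
    (X Y : field R) (b : momentum R) (s : R[i]) (p : Fock R) : Fock R :=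
  (qpow lq 1 - qpow lq (- 1))^-1 *:
    (normexp lq k X b (s + 1) p - normexp lq k Y b (s + 1) p).

Definition bosonic_dom (R : realType) (k : 'I_3 -> R[i]) (i : 'I_3)
    (b : momentum R) : Prop :=
  exists m : int,
    zeromode k (bos (i + 1)) b + zeromode k (bos (i + 2%:R)) b
    = (k i + 2%:R) * m%:~R.

(* r_i^+ and r_i^- (resp. t_i^+ and t_i^-) carry the same momentum. *)
Definition rho (R : realType) (lq : R[i]) (k : 'I_3 -> R[i]) (i : 'I_3) :
    operator R :=
  Operator (field_mom (rfield lq k i 1)) (bosonic_dom k i)
    (fun b => qdiff lq k (rfield lq k i 1) (rfield lq k i (- 1)) b (- 1)).

Definition tau (R : realType) (lq : R[i]) (k : 'I_3 -> R[i]) (i : 'I_3) :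
    operator R :=
  Operator (field_mom (tfield lq k i 1)) (bosonic_dom k i)
    (fun b => qdiff lq k (tfield lq k i 1) (tfield lq k i (- 1)) b (- 1)).

Definition comp_dom (R : realType) (A B : operator R) (b : momentum R) : Prop :=
  op_dom B b /\ op_dom A (b + op_mom B).

(* [A, B] = 0 on each sector on which both A B and B A are defined. *)
Definition commute_on_sectors (R : realType) (A B : operator R) : Prop :=
  forall b, comp_dom A B b -> comp_dom B A b ->
  forall v, sector b v -> op_app A (op_app B v) - op_app B (op_app A v) = 0.

Definition anticommute_on_sectors (R : realType) (A B : operator R) : Prop :=
  forall b, comp_dom A B b -> comp_dom B A b ->
  forall v, sector b v -> op_app A (op_app B v) + op_app B (op_app A v) = 0.

(* Main.v *)
From HB Require Import structures.
Require Import Defs.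
From mathcomp Require Import all_boot all_order all_algebra finmap.
From mathcomp Require Import boolp classical_sets fsbigop reals sequences exp trigo.
From mathcomp Require Import complex monalg.
From mathcomp Require Import ring lra zify.

(** The product of two vertex operators :e^{X(z)}: :e^{Y(w)}: is a scalar series
    in w/z, the contraction exp (sum_n [X_n, Y_{-n}] (w/z)^n) times a power of z,
    times the normally ordered exponential :e^{X(z)+Y(w)}:, because the
    commutators of the modes are scalars. For the currents at hand the
    contraction is a rational function with at most one pole, and the product in
    the opposite order is the expansion of the same rational function (up to
    sign) in the opposite region. So the (anti)commutator of the currents is
    zero when there is no pole, and otherwise a formal delta function
    sum_(i in Z) (gamma w/z)^i times :e^{X(z)+Y(w)}:; taking residues turns it
    into one coefficient of :e^{X(gamma w)+Y(w)}:. This is [vertex_exchange] and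
    [normexp_exchange]: the hypothesis is an identity between the coefficients
    of the two expansions and lam sum_i (gamma t)^i, where lam = 0 covers the
    case without a pole.

    The currents of rho_i and tau_i all have the shape
    -a_A(N;z) - a_B(N;q^{-eN}z) for a pair {A, B} of bosons and a sign e, with
    N = c_AB + 1, where c is the matrix of couplings. Besides c_AA = 1 and
    symmetry, the contractions rest on c_AB + c_AC + c_BC = -1 for distinct
    A, B, C ([cpl_triple]), which is the condition k_1 + k_2 + k_3 = -4. With it
    a single q-number identity ([qbracket_twist]) gives every contraction:
    - a_C against the pair {A, B}: 1 - gamma t, no pole;
    - a_A against the pair {A, B}: 1/(1 - gamma t), a simple pole;
    - {A, B} with sign e against {B, C} with sign d: trivial if d = -e, and
      (1 - q^{2e} gamma t)/(1 - gamma t) if d = e.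

    A bosonic screening operator is the difference of the two signs e = 1 and
    e = -1, and each sign contributes the coefficient of z^0 in an exponential
    :e^{Z^e(z)}:. The point of the construction is that
    Z^-(z) = Z^+(q^s z) for some s ([sigma_pair_shift], [pair_pair_shift]), and
    the coefficient of z^0 does not change under z -> q^s z. Hence the two
    contributions cancel. Exchanging A and B also amounts to such a shift,
    together with e -> -e, so it only changes the sign of the screening operator
    ([screening_swap]). Any two of the pairs attached to rho_i, rho_j, or rho_i,
    tau_j, or tau_i, tau_j with i != j share exactly one boson, so up to signs
    all the commutators are of the form {A, B} against {B, C}. *)

Set Implicit Arguments.
Unset Strict Implicit.
Unset Printing Implicit Defensive.
Import Order.TTheory GRing.Theory Num.Theory.
Local Open Scope ring_scope.

(** * Coefficients of operator exponentials *)

Section Exp.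
Variables (K : numFieldType) (V : lmodType K).
Implicit Types (x y z : nat -> {linear V -> V}) (e f : int -> V).

(** The coefficients of e(t) = exp (sum_(n > 0) x_n t^n) e_0 are determined by
    e_0 and the differential equation t e'(t) = (sum_n n x_n t^n) e(t), which
    avoids powers and factorials. Coefficients are indexed by integers, with
    value 0 below 0, so that shifted indices need no side conditions. *)
Definition exp_seq x e :=
  (forall m : int, m < 0 -> e m = 0) /\
  (forall (m : int) (B : nat), m < B%:Z ->
     m%:~R *: e m = \sum_(1 <= n < B) n%:R *: x n (e (m - n%:Z))).

Lemma sum_nat_extend (f : nat -> V) (a B B' : nat) : (B <= B')%N ->
  (forall n, (B <= n)%N -> f n = 0) -> \sum_(a <= n < B') f n = \sum_(a <= n < B) f n.
Proof.
move=> le f0; have [aB|Ba] := leqP a B.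
  rewrite (big_cat_nat aB le) /= [X in _ + X]big_nat_cond [X in _ + X]big1 ?addr0 //.
  by move=> n /andP[/andP[h _] _]; exact: f0.
rewrite [RHS]big_geq ?(ltnW Ba) // big_nat_cond big1 // => n /andP[/andP[h _] _].
by apply: f0; apply: leq_trans (ltnW Ba) h.
Qed.

Lemma sum_nat_bound (f : nat -> V) (a B B' : nat) :
  (forall n, (B <= n)%N -> f n = 0) -> (forall n, (B' <= n)%N -> f n = 0) ->
  \sum_(a <= n < B) f n = \sum_(a <= n < B') f n.
Proof.
move=> fB fB'; case: (leqP B B') => h; first by rewrite (sum_nat_extend _ h).
by rewrite (sum_nat_extend _ (ltnW h)).
Qed.

(** The c first terms of the shifted sum have a negative index. *)
Lemma sum_shift (f : int -> V) (c B : nat) : (forall m : int, m < 0 -> f m = 0) ->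
  \sum_(0 <= a < B) f (a%:Z - c%:Z) = \sum_(0 <= a < B - c) f a%:Z.
Proof.
move=> f0; have [cB|Bc] := leqP c B.
  rewrite (big_cat_nat (leq0n c) cB) /= big_nat_cond big1 ?add0r; last first.
    by move=> a /andP[/andP[_ h] _]; apply: f0; lia.
  rewrite -{1}[c]add0n big_addn; apply: eq_bigr => a _; congr f; lia.
rewrite [RHS]big_geq; last lia.
by rewrite big_nat_cond big1 // => a /andP[/andP[_ h] _]; apply: f0; lia.
Qed.

Lemma exp_seq_intro x e : (forall m : int, m < 0 -> e m = 0) ->
  (forall m : int, 0 <= m -> exists2 B : nat, m < B%:Z &
     m%:~R *: e m = \sum_(1 <= n < B) n%:R *: x n (e (m - n%:Z))) -> exp_seq x e.
Proof.
move=> e0 h; split=> // m B mB; have [m0|m0] := ltP m 0.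
  rewrite e0 // scaler0 big1 // => n _; rewrite e0 ?linear0 ?scaler0 //; lia.
have [B' mB' ->] := h m m0.
apply: sum_nat_bound => n hn; rewrite e0 ?linear0 ?scaler0 //; lia.
Qed.

Lemma exp_seq_uniq x e f : exp_seq x e -> exp_seq x f -> e 0 = f 0 -> e =1 f.
Proof.
move=> [e0 he] [f0 hf] h0.
suff H (N : nat) (m : nat) : (m <= N)%N -> e m%:Z = f m%:Z.
  by case=> m; [exact: H (leqnn m) | rewrite e0 ?f0].
elim: N m => [|N IH] [|m] // mN.
have nz : m.+1%:Z%:~R != 0 :> K by rewrite intr_eq0.
apply: (scalerI nz).
rewrite (he _ m.+2) ?(hf _ m.+2) //; try lia.
apply: eq_big_nat => n /andP[n1 n2].
have -> : m.+1%:Z - n%:Z = (m.+1 - n)%N%:Z by lia.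
rewrite IH //; lia.
Qed.

(** exp x exp y = exp (x + y) for commuting exponents. Here u i j stands for
    the product of the coefficients of degree i and j; that the exponents
    commute is hidden in the two hypotheses on u, which put x_n, respectively
    y_n, in the leftmost position. *)
Lemma exp_seq_conv x y z (u : int -> int -> V) (w : int -> V) :
  (forall n v, (0 < n)%N -> z n v = x n v + y n v) ->
  (forall j, exp_seq x (u^~ j)) -> (forall i, exp_seq y (u i)) ->
  (forall l : int, l < 0 -> w l = 0) ->
  (forall (l : int) (B : nat), l < B%:Z -> w l = \sum_(0 <= i < B) u i%:Z (l - i%:Z)) ->
  exp_seq z w.
Proof.
move=> hz hx hy w0 hw; apply: exp_seq_intro => // l l0.
exists `|l|.+1; first lia.
set B := `|l|.+1.
have lB : l < B%:Z by lia.
rewrite (hw _ B) // scaler_sumr.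
transitivity (\sum_(0 <= i < B) (\sum_(1 <= n < B) n%:R *: x n (u (i%:Z - n%:Z) (l - i%:Z))
   + \sum_(1 <= n < B) n%:R *: y n (u i%:Z (l - i%:Z - n%:Z)))).
  apply: eq_big_nat => i /andP[_ iB].
  rewrite -(proj2 (hx (l - i%:Z))) //.
  rewrite -(proj2 (hy i%:Z)); last lia.
  by rewrite -scalerDl -intrD addrCA subrr addr0.
rewrite big_split /= exchange_big /= [X in _ + X]exchange_big /= -big_split /=.
apply: eq_big_nat => n /andP[n1 nB].
rewrite -!scaler_sumr -scalerDr hz //; congr (_ *: (_ + _)).
  rewrite -linear_sum (hw (l - n%:Z) (B - n)%N); last lia.
  congr (x n _).
  rewrite -(sum_shift (f := fun m => u m (l - n%:Z - m))) => [|m m0]; last first.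
    by rewrite (proj1 (hx _)).
  by apply: eq_bigr => i _; congr u; lia.
rewrite -linear_sum (hw _ B); last lia.
by congr (y n _); apply: eq_bigr => i _; congr u; lia.
Qed.

(** The substitution t -> gamma t, with g m = gamma^m. *)
Lemma exp_seq_scale x y (g : int -> K) e :
  (forall m n, g (m + n) = g m * g n) ->
  (forall n v, (0 < n)%N -> y n v = g n%:Z *: x n v) ->
  exp_seq x e -> exp_seq y (fun m => g m *: e m).
Proof.
move=> gD hy [e0 he]; split=> [m m0|m B mB]; first by rewrite e0 ?scaler0.
rewrite scalerA mulrC -scalerA (he m B) // scaler_sumr.
apply: eq_big_nat => n /andP[n1 _]; rewrite hy // [x n (_ *: _)]linearZ /= !scalerA.
have -> : g m = g (m - n%:Z) * g n%:Z by rewrite -gD subrK.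
congr (_ *: _); ring.
Qed.

(** If [D, x_n] is a scalar, nonzero only for n = n0, then D exp x = exp x (D +
    c t^n0): both sides solve the same differential equation. *)
Lemma exp_seq_commutator x (D : {linear V -> V}) (n0 : nat) (c : K) e e' :
  (0 < n0)%N ->
  (forall n v, (0 < n)%N -> D (x n v) = x n (D v) + (if n == n0 then c else 0) *: v) ->
  exp_seq x e -> exp_seq x e' -> e' 0 = D (e 0) ->
  forall m, D (e m) = e' m + c *: e (m - n0%:Z).
Proof.
move=> n00 hD he he' h0 m.
suff H : exp_seq x (fun m => D (e m) - c *: e (m - n0%:Z)).
  move: m; suff: (fun m => D (e m) - c *: e (m - n0%:Z)) =1 e' by move=> h m; rewrite -h subrK.
  apply: exp_seq_uniq H he' _.
  by rewrite h0 (proj1 he (0 - n0%:Z)) ?scaler0 ?subr0 //; lia.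
have [e0 hr] := he.
apply: exp_seq_intro => [i i0|i i0].
  by rewrite !e0 ?(linear0 D) ?scaler0 ?subr0 //; lia.
exists (`|i| + n0).+1; first lia.
set B := (`|i| + n0).+1.
have -> : i%:~R *: (D (e i) - c *: e (i - n0%:Z)) = D (i%:~R *: e i)
     - c *: (((i - n0%:Z)%:~R) *: e (i - n0%:Z)) - (n0%:R * c) *: e (i - n0%:Z).
  rewrite [D (_ *: _)]linearZ /= scalerBr scalerA [X in _ =
    _ - X - _]scalerA -addrA -opprD -scalerDl.
  congr (_ - _ *: _); rewrite intrB -[n0%:~R]/(n0%:R : K); ring.
rewrite (hr i B) ?(hr (i - n0%:Z) B); try lia.
rewrite linear_sum scaler_sumr -sumrB.
have n0B : n0 \in index_iota 1 B by rewrite mem_index_iota; lia.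
rewrite (bigD1_seq n0 n0B (iota_uniq _ _)) /=.
rewrite [RHS](bigD1_seq n0 n0B (iota_uniq _ _)) /=.
rewrite addrAC; congr (_ + _).
  rewrite [D (_ *: _)]linearZ /= hD // eqxx [x _ (_ - _)]linearB [x _ (_ *: _)]linearZ /=
    scalerBr scalerDr.
  rewrite -!addrA; congr (_ + _).
  by rewrite -scalerA addrCA addrN addr0 !scalerA mulrC.
rewrite big_nat_cond [RHS]big_nat_cond; apply: eq_bigr => n.
move=> /andP[/andP[n1 nB]] nn0.
rewrite [D (_ *: _)]linearZ /= hD // (negbTE nn0) scale0r addr0 [x _ (_ - _)]linearB.
rewrite [x _ (_ *: _)]linearZ /= scalerBr.
by rewrite !scalerA mulrC [i - n%:Z - _]addrAC.
Qed.

End Exp.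

(** * Multiplications and derivations of polynomial algebras *)

Section MulOp.
Variables (K : comNzRingType) (A : comAlgType K).

Definition mulop (a v : A) : A := a * v.

Lemma mulop_is_linear a : linear (mulop a).
Proof. by move=> c u v; rewrite /mulop mulrDr scalerAr. Qed.

HB.instance Definition _ a := GRing.isLinear.Build K A A *:%R (mulop a) (mulop_is_linear a).

End MulOp.

Section MalgScale.
Variables (S : nzRingType) (T : choiceType).

Lemma malgZU (a c : S) (m : T) : << a * c *g m >> = a *: << c *g m >>.
Proof. by apply/malgP=> k; rewrite mcoeffZ !mcoeffU mulrnAr. Qed.

End MalgScale.

Section Deriv.
Variables (S : comNzRingType) (I : choiceType).
Local Notation F := {malg S[{cmonom I}]}.
Implicit Types (x y : I) (p : F).

Fact mderiv_key : unit. Proof. exact: tt. Qed.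

(** The partial derivative with respect to the variable x. *)
Definition mderiv x p : F :=
  locked_with mderiv_key (\sum_(m <- msupp p) << p@_m *+ m x *g divcm m (ucm x) >>).

Lemma mderivEw x p (d : {fset {cmonom I}}) : (msupp p `<=` d)%fset ->
  mderiv x p = \sum_(m <- d) << p@_m *+ m x *g divcm m (ucm x) >>.
Proof.
move=> le; rewrite /mderiv unlock.
apply: (big_fset_incl _ le) => m md /mcoeff_outdom ->.
by rewrite mul0rn monalgU0.
Qed.

Lemma mderiv_is_linear x : linear (mderiv x).
Proof.
move=> a p q.
pose d := (msupp p `|` msupp q `|` msupp (a *: p + q))%fset.
rewrite !(@mderivEw x _ d) ?fsubsetUr //; last 2 first.
- by rewrite /d (fsetUC (msupp p)) -fsetUA fsubsetUl.
- by rewrite /d -fsetUA fsubsetUl.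
rewrite scaler_sumr -big_split /=; apply: eq_bigr => m _.
rewrite mcoeffD mcoeffZ mulrnDl monalgUD; congr (_ + _).
by rewrite -mulrnAr malgZU.
Qed.

HB.instance Definition _ x :=
  GRing.isLinear.Build S F F *:%R (mderiv x) (mderiv_is_linear x).

Lemma mderivU x (c : S) (m : {cmonom I}) :
  mderiv x << c *g m >> = << c *+ m x *g divcm m (ucm x) >>.
Proof. by rewrite (mderivEw _ msuppU_le) big_seq_fset1 mcoeffUU. Qed.

Lemma mderiv1 x : mderiv x 1 = 0.
Proof. by rewrite -[1]/(<< _ *g _ >>) mderivU cm1 mulr0n monalgU0. Qed.

Lemma malg_lin_ind (P : F -> Prop) :
  (forall a p q, P p -> P q -> P (a *: p + q)) ->
  (forall m : {cmonom I}, P << m >>) -> forall p, P p.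
Proof.
move=> PL PU p.
have P0 : P 0 by rewrite -(addNr << mone >>) -scaleN1r; exact: PL.
rewrite (monalgE p); elim/big_rec: _ => // m q _ Pq.
by rewrite -[p@_m]mulr1 malgZU; exact: PL.
Qed.

Lemma malg_lin_ext (f g : {linear F -> F}) :
  (forall m : {cmonom I}, f << m >> = g << m >>) -> f =1 g.
Proof.
move=> fg; apply: malg_lin_ind => // a p q hp hq.
by rewrite (linearP f) (linearP g) hp hq.
Qed.

Lemma varMU x (c : S) m : << ucm x >> * << c *g m >> = << c *g (mmul (ucm x) m) >>.
Proof. by rewrite malgM_def fgmulUU mul1r. Qed.

(** The canonical commutation relation between derivatives and variables. *)
Lemma mderiv_var x y p :
  mderiv x (<< ucm y >> * p) = (x == y)%:R *: p + << ucm y >> * mderiv x p.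
Proof.
pose f := [the {linear F -> F} of mderiv x \o mulop << ucm y >>].
pose g := [the {linear F -> F} of
  ((x == y)%:R \*: idfun) \+ (mulop << ucm y >> \o mderiv x)].
suff fg : f =1 g by exact: fg p.
apply: malg_lin_ext => m.
suff : mderiv x (<< ucm y >> * << m >>) =
  (x == y)%:R *: << m >> + << ucm y >> * mderiv x << m >> by [].
rewrite [X in mderiv x X]varMU.
rewrite [in LHS]mderivU.
rewrite [in RHS]mderivU.
rewrite [X in _ = _ + X]varMU.
rewrite cmM cmU.
have [->|xy] := eqVneq x y.
  rewrite scale1r add1n mulrSr.
  have -> : divcm (mmul (ucm y) m) (ucm y) = m.
    by apply/eqP/cmP => i; rewrite divcmE cmM addnC addnK.
  have [->|my] := eqVneq (m y) 0%N; first by rewrite mulr0n monalgU0 add0r addr0.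
  have -> : mmul (ucm y) (divcm m (ucm y)) = m.
    apply/eqP/cmP => i; rewrite cmM divcmE cmU.
    by case: eqP => [<-|_] //=; lia.
  by rewrite -monalgUD addrC.
rewrite scale0r add0r [(_ + m x)%N]add0n.
have [mx|mx] := eqVneq (m x) 0%N.
  have Z k : << (m x)%:R *g k >> = 0 :> F by rewrite mx mulr0n monalgU0.
  exact: etrans (Z _) (esym (Z _)).
apply: (congr1 (fun k => << (m x)%:R *g k >>)).
apply/eqP/cmP => i; rewrite divcmE !cmM divcmE !cmU.
case: (eqVneq x i) => [<-|_] //=; last by rewrite !subn0.
by rewrite eq_sym (negbTE xy).
Qed.

Lemma malg_var_ind (P : F -> Prop) : P 1 ->
  (forall a p q, P p -> P q -> P (a *: p + q)) ->
  (forall x p, P p -> P (<< ucm x >> * p)) -> forall p, P p.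
Proof.
move=> P1 PL Pg; apply: (malg_lin_ind PL) => m.
have [n] := ubnP (mdeg m); elim: n m => [m h|n IH m mn]; first by exfalso; rewrite ltn0 in h.
have [m1|m1] := eqVneq m mone; first (rewrite m1; exact: P1).
have /fset0Pn[x xm] : finsupp m != fset0.
  apply: contra_neq m1 => m0; apply: mdeg_eq0I.
  by rewrite mdegE m0 big_seq_fset0.
have mE : mmul (ucm x) (divcm m (ucm x)) = m.
  apply/eqP/cmP => i; rewrite cmM divcmE cmU.
  case: eqP => [<-|_] //=; move: xm; rewrite -cmE_neq0; lia.
rewrite -mE -(varMU x 1); apply: Pg; apply: IH.
by move: mn; rewrite -{1}mE mdegM mdegU add1n.
Qed.

Lemma mderivC x y p : mderiv x (mderiv y p) = mderiv y (mderiv x p).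
Proof.
elim/malg_var_ind: p => [|a p q hp hq|z p hp].
- by rewrite [mderiv y 1]mderiv1 [mderiv x 1]mderiv1 !linear0.
- transitivity (a *: mderiv x (mderiv y p) + mderiv x (mderiv y q)).
    rewrite (mderiv_is_linear y a p q); exact: (mderiv_is_linear x).
  transitivity (a *: mderiv y (mderiv x p) + mderiv y (mderiv x q)).
    exact: (congr2 (fun u v => a *: u + v) hp hq).
  apply: esym.
  rewrite (mderiv_is_linear x a p q); exact: (mderiv_is_linear y).
transitivity ((y == z)%:R *: mderiv x p + ((x == z)%:R *: mderiv y p +
    << ucm z >> * mderiv x (mderiv y p))).
  apply: etrans (congr1 (mderiv x) (mderiv_var y z p)) _.
  apply: etrans (mderiv_is_linear x _ _ _) _.
  exact: (congr1 (+%R _) (mderiv_var _ _ _)).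
apply: etrans (addrCA _ _ _) _; apply: esym.
apply: etrans (congr1 (mderiv y) (mderiv_var x z p)) _.
apply: etrans (mderiv_is_linear y _ _ _) _.
apply: etrans (congr1 (+%R _) (mderiv_var _ _ _)) _.
exact: (congr1 (fun u => _ + (_ + _ * u)) (esym hp)).
Qed.

End Deriv.

(** * Exponentials of commuting operators *)

Section ExpCoef.
Variables (K : numFieldType) (V : lmodType K).
Variable x : nat -> {linear V -> V}.
Hypothesis xC : forall n k v, (0 < n)%N -> (0 < k)%N -> x n (x k v) = x k (x n v).

Definition exp_pow (y : nat -> V -> V) (p : V) (r : nat) : nat -> V :=
  iter r (fun f m => \sum_(1 <= n < m.+1) y n (f (m - n)%N))
    (fun d => if d is 0%N then p else 0).

Definition expz (y : nat -> V -> V) (p : V) (m : int) : V :=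
  if m is Posz m then \sum_(r < m.+1) (r`!%:R)^-1 *: exp_pow y p r m else 0.

Let P p r (m : int) : V := if m is Posz m then exp_pow x p r m else 0.

Let Pneg p r m : m < 0 -> P p r m = 0. Proof. by case: m. Qed.

Let PS p r (m : int) (B : nat) : m < B%:Z ->
  P p r.+1 m = \sum_(1 <= n < B) x n (P p r (m - n%:Z)).
Proof.
case: m => [m|m] mB; last first.
  by rewrite big1 // => n _; rewrite Pneg ?linear0 //; lia.
rewrite /P [LHS]/=.
transitivity (\sum_(1 <= n < m.+1) x n (P p r (m%:Z - n%:Z))).
  apply: eq_big_nat => n /andP[n1 nm].
  by have -> : m%:Z - n%:Z = (m - n)%N%:Z by lia.
apply: sum_nat_bound => n hn; rewrite Pneg ?linear0 //; lia.
Qed.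

Let Phom p r (m : int) (B : nat) : m < B%:Z ->
  m%:~R *: P p r m = r%:R *: \sum_(1 <= n < B) n%:R *: x n (P p r.-1 (m - n%:Z)).
Proof.
elim: r m => [|r IH] m mB.
  rewrite scale0r; case: m mB => [[|m]|m] _; rewrite ?scale0r //=.
    by rewrite scaler0.
  by rewrite scaler0.
rewrite (PS p r mB) [LHS]scaler_sumr /=.
transitivity (\sum_(1 <= n < B) (n%:R *: x n (P p r (m - n%:Z)) +
    r%:R *: \sum_(1 <= k < B) k%:R *: x k (x n (P p r.-1 (m - n%:Z - k%:Z))))).
  apply: eq_big_nat => n /andP[n1 nB].
  have -> : m%:~R = n%:R + (m - n%:Z)%:~R :> K.
    by rewrite intrB -[n%:~R]/(n%:R : K); ring.
  rewrite scalerDl; congr (_ + _).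
  rewrite -linearZ /= IH; last lia.
  rewrite linearZ /= linear_sum; congr (_ *: _).
  apply: eq_big_nat => k /andP[k1 kB].
  by rewrite linearZ /= xC.
rewrite big_split /= -scaler_sumr exchange_big /= mulrS scalerDl scale1r.
congr (_ + _); case: r {IH} => [|r]; first by rewrite !scale0r.
congr (_ *: _); apply: eq_big_nat => k /andP[k1 kB].
rewrite -scaler_sumr -linear_sum (PS p r (B := B)); last lia.
by congr (_ *: x k _); apply: eq_bigr => n _; rewrite addrAC.
Qed.

Let Pdeg p r (m : nat) : (m < r)%N -> P p r m%:Z = 0.
Proof.
elim: r m => // r IH m mr; rewrite (PS p r (B := m.+1)) //; last lia.
rewrite big_nat_cond big1 // => n /andP[/andP[n1 nm] _].
have -> : m%:Z - n%:Z = (m - n)%N%:Z by lia.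
rewrite IH ?linear0 //; lia.
Qed.

Let expzE p (m : int) (B : nat) : m < B%:Z ->
  expz x p m = \sum_(0 <= r < B) (r`!%:R)^-1 *: P p r m.
Proof.
case: m => [m|m] mB /=; last by rewrite big1 // => r _; rewrite scaler0.
rewrite -(big_mkord xpredT (fun r => (r`!%:R)^-1 *: P p r m%:Z)).
apply: sum_nat_bound => r hr; rewrite Pdeg ?scaler0 //; lia.
Qed.

(** Euler's relation m [t^m] x^r = r [t^m] ((t x') x^(r-1)), valid because the
    x_n commute, summed over r with the weights 1/r!. *)
Lemma exp_coefP p : exp_seq x (expz x p).
Proof.
split=> [[]//|m B mB].
rewrite (expzE p (B := B.+1)) ?scaler_sumr ; last lia.
rewrite big_nat_recl // scalerA mulrC -scalerA (@Phom p 0%N _ _ mB) scale0r scaler0 add0r.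
transitivity (\sum_(0 <= r < B) \sum_(1 <= n < B)
    n%:R *: x n ((r`!%:R)^-1 *: P p r (m - n%:Z))).
  apply: eq_bigr => r _; rewrite scalerA mulrC -scalerA (@Phom p r.+1 _ _ mB) /=.
  rewrite scalerA factS natrM invfM -mulrA mulrCA mulVf ?mulr1 ?pnatr_eq0 //.
  by rewrite scaler_sumr; apply: eq_bigr => n _; rewrite [x n (_ *: _)]linearZ /= !scalerA mulrC.
rewrite exchange_big /=; apply: eq_bigr => n _.
by rewrite -scaler_sumr -linear_sum (expzE p (B := B)) //; lia.
Qed.

Lemma expz0 p : expz x p 0 = p.
Proof. by rewrite /expz /= big_ord_recl big_ord0 /= fact0 invr1 scale1r addr0. Qed.

End ExpCoef.

(** * Exchange of annihilation and creation exponentials *)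

Section Window.
Variables (K : numFieldType) (V : lmodType K).
Implicit Types (f : int -> V).

(** Both sums run over the whole support of f. *)
Lemma sum_window f (s : int) (B U : nat) :
  (forall u : int, u < 0 -> f u = 0) -> (forall u : int, U%:Z <= u -> f u = 0) ->
  (forall u : int, u < s -> f u = 0) -> (forall u : int, s + B%:Z <= u -> f u = 0) ->
  \sum_(0 <= c < B) f (s + c%:Z) = \sum_(0 <= u < U) f u%:Z.
Proof.
move=> f0 fU fs fB; case: s fs fB => k fs fB.
  transitivity (\sum_(0 <= u < k + B) f u%:Z).
    rewrite (big_cat_nat (leq0n k) (leq_addr B k)) /= [X in _ = X + _]big_nat_cond.
    rewrite [X in _ = X + _]big1 ?add0r; last first.
      by move=> u /andP[/andP[_ h] _]; apply: fs; lia.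
    rewrite -{2}[k]add0n big_addn addKn.
    by apply: eq_bigr => c _; congr f; lia.
  by apply: sum_nat_bound => n hn; [apply: fB|apply: fU]; lia.
transitivity (\sum_(0 <= c < B) f (c%:Z - k.+1%:Z)).
  by apply: eq_bigr => c _; congr f; lia.
rewrite sum_shift //.
by apply: sum_nat_bound => n hn; [apply: fB|apply: fU]; lia.
Qed.

Lemma sum_window_rev f (s : int) (B U : nat) :
  (forall u : int, u < 0 -> f u = 0) -> (forall u : int, U%:Z <= u -> f u = 0) ->
  (forall u : int, s < u -> f u = 0) -> (forall u : int, u <= s - B%:Z -> f u = 0) ->
  \sum_(0 <= c < B) f (s - c%:Z) = \sum_(0 <= u < U) f u%:Z.
Proof.
move=> f0 fU fs fB; rewrite big_nat_rev /= -(@sum_window f (s - B%:Z + 1) B) //.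
- by apply: eq_big_nat => c /andP[_ cB]; congr f; lia.
- by move=> u hu; apply: fB; lia.
by move=> u hu; apply: fs; lia.
Qed.

Lemma sum_square (f : int -> int -> V) (W : nat) :
  (forall (x : int) (y : int), y < 0 -> f x y = 0) ->
  (forall (x : int) (y : int), W%:Z <= x -> f x y = 0) ->
  (forall (x : int) (y : int), W%:Z <= y -> f x y = 0) ->
  \sum_(0 <= x < W) \sum_(0 <= y < W) f x%:Z y%:Z =
  \sum_(0 <= l < W + W) \sum_(0 <= x < W + W) f x%:Z (l%:Z - x%:Z).
Proof.
move=> f0 fx fy; rewrite [RHS]exchange_big /=.
transitivity (\sum_(0 <= x < W + W) \sum_(0 <= y < W + W - x) f x%:Z y%:Z); last first.
  by apply: eq_bigr => x _; rewrite (sum_shift (f := f x%:Z)) // => m m0; rewrite f0.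
rewrite [RHS](@sum_nat_extend _ _ _ _ W) ?leq_addr //; last first.
  by move=> n hn; rewrite big1 // => y _; apply: fx; lia.
apply: eq_big_nat => x xW; apply: sum_nat_bound => y hy; apply: fy; lia.
Qed.

End Window.

Section ExpMul.
Variables (K : numFieldType) (A : comAlgType K).

Lemma exp_seq_mulr (c : nat -> A) P v :
  exp_seq (fun n => mulop (c n)) P -> exp_seq (fun n => mulop (c n)) (fun m => P m * v).
Proof.
move=> [P0 hP]; split=> [m m0|m B mB]; first by rewrite P0 ?mul0r.
rewrite scalerAl (hP m B) // mulr_suml; apply: eq_bigr => n _.
by rewrite -scalerAl /= /mulop mulrA.
Qed.

End ExpMul.

Section Exchange.
Variables (K : numFieldType) (A : comAlgType K).
Variables (d : nat -> {linear A -> A}) (c : nat -> A) (kap : nat -> K).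
Variables (P : int -> A) (E : int -> A -> A) (C : int -> K).
Hypothesis dC : forall n k v, (0 < n)%N -> (0 < k)%N ->
  d n (c k * v) = c k * d n v + (if k == n then kap n else 0) *: v.
Hypothesis hP : exp_seq (fun n => mulop (c n)) P.
Hypothesis hE : forall v, exp_seq d (E^~ v).
Hypothesis P0 : P 0 = 1.
Hypothesis E0 : forall v, E 0 v = v.
Hypothesis hC : exp_seq (V := K^o) (fun n => mulop (A := K^o) (kap n)) C.
Hypothesis C0 : C 0 = 1.

(** [d_n, exp (sum_k c_k t^k)] = kap_n t^n exp (sum_k c_k t^k), the commutator
    being scalar. *)
Lemma annih_creation n (b : int) v : (0 < n)%N ->
  d n (P b * v) = P b * d n v + kap n *: (P (b - n%:Z) * v).
Proof.
move=> n0.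
apply: (@exp_seq_commutator _ _ (fun k => mulop (c k)) (d n) n (kap n)
   (fun b => P b * v) (fun b => P b * d n v)) => //.
- by move=> k u k0; rewrite /= /mulop dC.
- exact: exp_seq_mulr.
- exact: exp_seq_mulr.
by rewrite P0 !mul1r.
Qed.

(** exp A(s) exp B(t) = C(st) exp B(t) exp A(s) when the commutators [A_n, B_k]
    are the scalars kap_n for k = n and vanish otherwise, with C = exp (sum_n
    kap_n t^n). As functions of s both sides solve the equation with exponent A
    and agree at s = 0. *)
Lemma exchange (a b : int) (B : nat) v : b < B%:Z ->
  E a (P b * v) = \sum_(0 <= i < B) C i%:Z *: (P (b - i%:Z) * E (a - i%:Z) v).
Proof.
move=> bB.
have Eneg m u : m < 0 -> E m u = 0 by move=> m0; apply: (proj1 (hE u)).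
have Pneg m : m < 0 -> P m = 0 by apply: (proj1 hP).
(* One more term, so that the sum contains the term i = 0 even for B = 0. *)
pose rhs (a : int) := \sum_(0 <= i < B.+1) C i%:Z *: (P (b - i%:Z) * E (a - i%:Z) v).
have -> : \sum_(0 <= i < B) C i%:Z *: (P (b - i%:Z) * E (a - i%:Z) v) = rhs a.
  by rewrite /rhs big_nat_recr //= (Pneg (b - B%:Z)) ?mul0r ?scaler0 ?addr0 //; lia.
move: a; apply: (exp_seq_uniq (hE _)); last first.
  rewrite E0 /rhs big_nat_recl // C0 scale1r !subr0 E0 big1 ?addr0 // => i _.
  by rewrite Eneg ?mulr0 ?scaler0 //; lia.
apply: exp_seq_intro => [m m0|m m0].
  by rewrite /rhs big1 // => i _; rewrite Eneg ?mulr0 ?scaler0 //; lia.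
exists (`|m| + B).+2; first lia.
set N := (`|m| + B).+2.
rewrite /rhs scaler_sumr.
transitivity (\sum_(0 <= i < B.+1) (\sum_(1 <= n < N)
      (n%:R * (kap n * C (i%:Z - n%:Z))) *: (P (b - i%:Z) * E (m - i%:Z) v)
    + \sum_(1 <= n < N) n%:R *: (C i%:Z *: (P (b - i%:Z) * d n (E (m - i%:Z - n%:Z) v))))).
  apply: eq_big_nat => i /andP[_ iB].
  have -> : m%:~R = i%:~R + (m - i%:Z)%:~R :> K by rewrite -intrD addrC subrK.
  rewrite scalerDl; congr (_ + _).
    rewrite scalerA -scaler_suml; congr (_ *: _).
    apply: etrans (proj2 hC i%:Z N _) _; first lia.
    by apply: eq_bigr.
  rewrite [LHS]scalerA [X in X *: _ =
    _]mulrC -[LHS]scalerA scalerAr (proj2 (hE v) (m - i%:Z) N); last lia.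
  rewrite mulr_sumr scaler_sumr; apply: eq_bigr => n _.
  by rewrite -scalerAr !scalerA [C _ * _]mulrC.
rewrite big_split /= exchange_big /= [X in _ + X]exchange_big /= -big_split /=.
apply: eq_big_nat => n /andP[n1 nN].
rewrite -[X in _ + X]scaler_sumr [d n _]linear_sum /=.
rewrite [X in X + _](eq_bigr (fun i => n%:R *: ((kap n * C (i%:Z - n%:Z)) *:
    (P (b - i%:Z) * E (m - i%:Z) v)))); last by move=> i _; rewrite scalerA.
rewrite -[X in X + _]scaler_sumr -scalerDr; congr (_ *: _).
rewrite [RHS](eq_bigr (fun i => (kap n * C i%:Z) *:
     (P (b - i%:Z - n%:Z) * E (m - i%:Z - n%:Z) v) +
     C i%:Z *: (P (b - i%:Z) * d n (E (m - i%:Z - n%:Z) v)))); last first.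
  move=> i _; rewrite [m - n%:Z - _]addrAC linearZ /= annih_creation // scalerDr.
  by rewrite [LHS]addrC scalerA [C _ * _]mulrC.
rewrite big_split /=; congr (_ + _).
pose f (i : int) := (kap n * C i) *: (P (b - i - n%:Z) * E (m - i - n%:Z) v).
transitivity (\sum_(0 <= i < B.+1) f (i%:Z - n%:Z)).
  by apply: eq_bigr => i _; rewrite /f; congr (_ *: (P _ * E _ _)); lia.
rewrite sum_shift; last by move=> i i0; rewrite /f (proj1 hC) // mulr0 scale0r.
apply: sum_nat_bound => i hi; rewrite /f Pneg ?mul0r ?scaler0 //; lia.
Qed.

End Exchange.

(** * Products of normally ordered exponentials *)

Section LinearPack.
Variables (K : numFieldType) (V : lmodType K).

(** Turns the bare linearity of an operator into a structure to which the
    theory of linear maps applies. *)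
Lemma linear_pack (f : V -> V) : linear f -> exists L : {linear V -> V}, f = L.
Proof.
move=> lf.
pose m := GRing.isLinear.Build K V V *:%R f lf.
by exists (HB.pack_for {linear V -> V} f m).
Qed.

Lemma linear_fun_sum (f : V -> V) (r : seq nat) (F : nat -> V) : linear f ->
  f (\sum_(i <- r) F i) = \sum_(i <- r) f (F i).
Proof. by move=> /linear_pack[L ->]; rewrite linear_sum. Qed.

Variables (d : nat -> {linear V -> V}) (E : int -> V -> V).
Hypothesis hE : forall v, exp_seq d (E^~ v).
Hypothesis E0 : forall v, E 0 v = v.

Lemma exp_seq_is_linear m : linear (E m).
Proof.
move=> a u v; move: m.
suff H : exp_seq d (fun m => a *: E m u + E m v).
  by apply: exp_seq_uniq (hE _) H _; rewrite !E0.
have [Eu hu] := hE u; have [Ev hv] := hE v.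
split=> [m m0|m B mB]; first by rewrite Eu ?Ev ?scaler0 ?addr0.
rewrite scalerDr (hv m B) // scalerA mulrC -scalerA (hu m B) // scaler_sumr -big_split /=.
by apply: eq_bigr => n _; rewrite [d n (a *: _ + _)]linearP /= scalerDr !scalerA mulrC.

Qed.

(** The case c = 0 of the commutator formula. *)
Lemma exp_seq_comm (L : V -> V) m v : linear L ->
  (forall n u, (0 < n)%N -> L (d n u) = d n (L u)) -> L (E m v) = E m (L v).
Proof.
move=> /linear_pack[{}L ->] hL.
rewrite (@exp_seq_commutator _ _ d L 1 0 (E^~ v) (E^~ (L v))) ?scale0r ?addr0 //.
  by move=> n u n0; rewrite hL // if_same scale0r addr0.
by rewrite !E0.
Qed.

End LinearPack.

Section Vertex.
Variables (K : numFieldType) (A : comAlgType K).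
Implicit Types (c : nat -> A) (d : nat -> {linear A -> A}).

(** The data of one vertex operator: creation modes c_n and annihilation modes
    d_n, with the coefficients P and E of their exponentials. The creation
    exponential is a multiplication, so it is determined by its value on 1. *)
Definition vertex c d (P : int -> A) (E : int -> A -> A) :=
  [/\ exp_seq (fun n => mulop (c n)) P, P 0 = 1,
      (forall v, exp_seq d (E^~ v)) & (forall v, E 0 v = v)].

(** The coefficient of z^S of the normally ordered exponential, applied to v.
    The sum over the annihilation part is cut off at W, which is harmless when
    E_x v = 0 for x >= W. *)
Definition vertex_coef (P : int -> A) (E : int -> A -> A) (S : int) (W : nat) (v : A) :=
  \sum_(0 <= x < W) P (S + x%:Z) * E x%:Z v.

(** The contraction factor of two fields whose modes have the commutators
    kap_n. *)
Definition scalar_exp (kap : nat -> K) (C : int -> K) :=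
  exp_seq (V := K^o) (fun n => mulop (A := K^o) (kap n)) C /\ C 0 = 1.

Definition contraction d c (kap : nat -> K) := forall n k v, (0 < n)%N -> (0 < k)%N ->
  d n (c k * v) = c k * d n v + (if k == n then kap n else 0) *: v.

(** Here i is the degree that a contraction moves from the annihilation part of
    X to the creation part of Y; it is bounded because creation parts have no
    negative degrees. *)
Lemma vertex_comp cX dX PX EX cY dY PY EY kap C (S T : int) (W W1 B : nat) v :
  vertex cX dX PX EX -> vertex cY dY PY EY ->
  contraction dX cY kap -> scalar_exp kap C ->
  (forall x y : int, W%:Z <= x -> EX x (EY y v) = 0) ->
  T + W%:Z <= B%:Z -> (W + B <= W1)%N ->
  vertex_coef PX EX S W1 (vertex_coef PY EY T W v) =
  \sum_(0 <= x < W) \sum_(0 <= y < W)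
    (\sum_(0 <= i < B) C i%:Z *: (PX (S + x%:Z + i%:Z) * PY (T + y%:Z - i%:Z))) *
    EX x%:Z (EY y%:Z v).
Proof.
move=> [hPX PX0 hEX EX0] [hPY PY0 hEY EY0] hc [hC C0] hW TB WB.
rewrite /vertex_coef.
transitivity (\sum_(0 <= a < W1) \sum_(0 <= y < W) \sum_(0 <= i < B)
  C i%:Z *: (PX (S + a%:Z) * PY (T + y%:Z - i%:Z) * EX (a%:Z - i%:Z) (EY y%:Z v))).
  apply: eq_bigr => a _; rewrite linear_fun_sum; last exact: exp_seq_is_linear hEX EX0 _.
  rewrite mulr_sumr; apply: eq_big_nat => y /andP[_ yW].
  rewrite (exchange hc hPY hEX PY0 EX0 hC C0 a%:Z (B := B)); last lia.
  by rewrite mulr_sumr; apply: eq_bigr => i _; rewrite -scalerAr mulrA.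
rewrite exchange_big [RHS]exchange_big /=; apply: eq_big_nat => y /andP[_ yW].
rewrite exchange_big /=.
transitivity (\sum_(0 <= i < B) \sum_(0 <= x < W)
  C i%:Z *: (PX (S + x%:Z + i%:Z) * PY (T + y%:Z - i%:Z) * EX x%:Z (EY y%:Z v))).
  apply: eq_big_nat => i /andP[_ iB].
  pose f (m : int) := C i%:Z *: (PX (S + m + i%:Z) * PY (T + y%:Z - i%:Z) * EX m (EY y%:Z v)).
  transitivity (\sum_(0 <= a < W1) f (a%:Z - i%:Z)).
    by apply: eq_bigr => a _; rewrite /f; congr (_ *: (PX _ * _ * _)); lia.
  rewrite sum_shift; last first.
    by move=> m m0; rewrite /f (proj1 (hEX _)) ?mulr0 ?scaler0.
  apply: (@sum_nat_bound _ _ (fun a => f a%:Z)) => n hn; rewrite /f hW ?mulr0 ?scaler0 //; lia.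
rewrite exchange_big /=; apply: eq_bigr => x _.
by rewrite mulr_suml; apply: eq_bigr => i _; rewrite scalerAl.
Qed.

Lemma vertex_comm cX dX PX EX cY dY PY EY x y v :
  vertex cX dX PX EX -> vertex cY dY PY EY ->
  (forall n k v, (0 < n)%N -> (0 < k)%N -> dX n (dY k v) = dY k (dX n v)) ->
  EX x (EY y v) = EY y (EX x v).
Proof.
move=> [hPX PX0 hEX EX0] [hPY PY0 hEY EY0] hd.
apply: esym; apply: (exp_seq_comm hEX EX0); first exact: exp_seq_is_linear hEY EY0 _.
move=> n u n0; apply: esym; apply: (exp_seq_comm hEY EY0) => [|k w k0].
  by move=> a u1 u2; rewrite linearP.
by rewrite hd.
Qed.

Section Ope.
Variables (cX cY cZ : nat -> A) (dX dY dZ : nat -> {linear A -> A}).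
Variables (PX PY PZ : int -> A) (EX EY EZ : int -> A -> A).
Variables (kap kap' : nat -> K) (C C' : int -> K) (zeta : int -> K).
Hypothesis vX : vertex cX dX PX EX.
Hypothesis vY : vertex cY dY PY EY.
Hypothesis vZ : vertex cZ dZ PZ EZ.
Hypothesis dC : forall n k v, (0 < n)%N -> (0 < k)%N -> dX n (dY k v) = dY k (dX n v).
Hypothesis hXY : contraction dX cY kap.
Hypothesis hYX : contraction dY cX kap'.
Hypothesis hC : scalar_exp kap C.
Hypothesis hC' : scalar_exp kap' C'.
Hypothesis zeta0 : zeta 0 = 1.
Hypothesis zetaD : forall m n, zeta (m + n) = zeta m * zeta n.
Hypothesis cZE : forall n v, (0 < n)%N -> cZ n * v = zeta n%:Z *: (cX n * v) + cY n * v.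
Hypothesis dZE : forall n v, (0 < n)%N -> dZ n v = zeta (- n%:Z) *: dX n v + dY n v.

(** exp of the creation part of X(gamma z) + Y(z), with zeta i = gamma^i. *)
Lemma creation_prod (M : int) (B : nat) : M < B%:Z ->
  PZ M = \sum_(0 <= i < B) zeta i%:Z *: (PX i%:Z * PY (M - i%:Z)).
Proof.
have [hPX PX0 _ _] := vX; have [hPY PY0 _ _] := vY; have [hPZ PZ0 _ _] := vZ.
pose u (i j : int) := (zeta i *: PX i) * PY j.
pose w (m : int) := \sum_(0 <= i < `|m|.+1) u i%:Z (m - i%:Z).
have un (i j : int) : j < 0 -> u i j = 0.
  by move=> j0; rewrite /u (proj1 hPY) // mulr0.
have wE (m : int) (N : nat) : m < N%:Z -> w m = \sum_(0 <= i < N) u i%:Z (m - i%:Z).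
  by move=> mN; apply: sum_nat_bound => n hn; apply: un; lia.
suff : PZ =1 w.
  move=> -> MB; rewrite (wE _ _ MB).
  by apply: eq_bigr => i _; rewrite scalerAl.
apply: exp_seq_uniq hPZ _ _; last first.
  by rewrite (wE 0 1) // big_nat1 /u subr0 zeta0 PX0 PY0 PZ0 scale1r mulr1.
have hsc : exp_seq (fun n => mulop (zeta n%:Z *: cX n)) (fun m => zeta m *: PX m).
  by apply: exp_seq_scale zetaD _ hPX => n v n0; rewrite /= /mulop scalerAl.
apply: (@exp_seq_conv _ _ _ (fun n => mulop (cY n)) _ u w _
  (fun j => exp_seq_mulr (PY j) hsc) _ _ wE) => [n v n0|i|m m0].
- by rewrite /= /mulop cZE // scalerAl.
- have -> : u i = (fun j => PY j * (zeta i *: PX i)).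
    by apply/funext => j; rewrite mulrC.
  exact: exp_seq_mulr.
by rewrite /w big_nat_cond big1 // => i _; rewrite un //; lia.
Qed.

Lemma annihilation_prod (l : int) (B : nat) v : l < B%:Z ->
  EZ l v = \sum_(0 <= i < B) zeta (- i%:Z) *: EX i%:Z (EY (l - i%:Z) v).
Proof.
have [_ _ hEX EX0] := vX; have [_ _ hEY EY0] := vY; have [_ _ hEZ EZ0] := vZ.
have EXl x : EX x 0 = 0.
  by have [L ->] := linear_pack (exp_seq_is_linear hEX EX0 x); rewrite linear0.
pose u (i j : int) := zeta (- i) *: EX i (EY j v).
pose w (m : int) := \sum_(0 <= i < `|m|.+1) u i%:Z (m - i%:Z).
have un (i j : int) : j < 0 -> u i j = 0.
  by move=> j0; rewrite /u (proj1 (hEY _)) // EXl scaler0.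
have wE (m : int) (N : nat) : m < N%:Z -> w m = \sum_(0 <= i < N) u i%:Z (m - i%:Z).
  by move=> mN; apply: sum_nat_bound => n hn; apply: un; lia.
suff : EZ^~ v =1 w by move=> /(_ l) /= ->; exact: wE.
apply: exp_seq_uniq (hEZ v) _ _; last first.
  by rewrite (wE 0 1) // big_nat1 /u subr0 oppr0 zeta0 EX0 EY0 EZ0 scale1r.
have zetaND (m n : int) : zeta (- (m + n)) = zeta (- m) * zeta (- n).
  by rewrite opprD zetaD.
pose x n := [the {linear A -> A} of zeta (- n%:Z) \*: dX n].
have hsc j : exp_seq x (u^~ j) by apply: exp_seq_scale zetaND _ (hEX _).
apply: exp_seq_conv _ hsc _ _ wE => [n w' n0|i|m m0].
- exact: dZE.
- have -> : u i = EY^~ (zeta (- i) *: EX i v).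
    apply/funext => j; rewrite /u (vertex_comm _ _ _ vX vY dC).
    by have [L ->] := linear_pack (exp_seq_is_linear hEY EY0 j); rewrite linearZ.
  exact: hEY.
by rewrite /w big_nat_cond big1 // => i _; rewrite un //; lia.
Qed.

(** phi C(t) and phi' C'(1/t) t^g are the contraction factors of the two
    orders, expanded in opposite directions, and the hypothesis says that they
    add up to the formal delta function lam sum_(i in Z) zeta(i) t^i, where
    zeta(i) = gamma^i. Multiplying the delta function by the normally ordered
    product sets the argument of X to gamma times that of Y, so only the
    exponential of Z(z) = X(gamma z) + Y(z) is left. *)
Lemma vertex_exchange (phi phi' lam : K) (g S T : int) (W : nat) v :
  (forall i, phi * C i + phi' * C' (g - i) = lam * zeta i) ->
  (forall x y : int, W%:Z <= x -> EX x (EY y v) = 0) ->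
  (forall x y : int, W%:Z <= y -> EX x (EY y v) = 0) ->
  exists N, forall W1 W2, (N <= W1)%N -> (N <= W2)%N ->
  phi *: vertex_coef PX EX S W1 (vertex_coef PY EY T W v) +
  phi' *: vertex_coef PY EY (T - g) W2 (vertex_coef PX EX (S + g) W v) =
  (lam * zeta (- S)) *: vertex_coef PZ EZ (S + T) (W + W) v.
Proof.
move=> hphi hx hy.
have [[PXn _] _ hEX EX0] := vX; have [[PYn _] _ hEY EY0] := vY.
have Cn i : i < 0 -> C i = 0 by apply: (proj1 (proj1 hC)).
have C'n i : i < 0 -> C' i = 0 by apply: (proj1 (proj1 hC')).
(* Larger than every degree that can be transferred by a contraction. *)
pose B := (`|S| + `|T| + `|g| + W + W).+1.
exists (W + B)%N => W1 W2 hW1 hW2.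
rewrite (vertex_comp S vX vY hXY hC hx (B := B)) //; last lia.
rewrite (vertex_comp (T - g) vY vX hYX hC' (W := W) (B := B)) //; last 2 first.
- by move=> x y h; rewrite -(vertex_comm _ _ _ vX vY dC) hy.
- lia.
rewrite [X in _ + _ *: X]exchange_big /= !scaler_sumr -big_split /=.
transitivity (\sum_(0 <= x < W) \sum_(0 <= y < W)
   (lam * zeta (- S)) *: (PZ (S + T + x%:Z + y%:Z) *
      (zeta (- x%:Z) *: EX x%:Z (EY y%:Z v)))).
  apply: eq_big_nat => x /andP[_ xW]; rewrite !scaler_sumr -big_split /=.
  apply: eq_big_nat => y /andP[_ yW].
  rewrite -(vertex_comm _ _ _ vX vY dC) !scalerAl -mulrDl -scalerAr scalerAl.
  congr (_ * _).
  rewrite (creation_prod (B := B)); last lia.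
  set M := S + T + x%:Z + y%:Z.
  pose Q (u : int) := PX u * PY (M - u).
  have Q0 u : u < 0 -> Q u = 0 by move=> u0; rewrite /Q PXn ?mul0r.
  have QB u : B%:Z <= u -> Q u = 0 by move=> uB; rewrite /Q PYn ?mulr0 //; lia.
  have -> : phi *: (\sum_(0 <= i < B) C i%:Z *: (PX (S + x%:Z + i%:Z) * PY (T + y%:Z - i%:Z)))
     = \sum_(0 <= u < B) (phi * C (u%:Z - (S + x%:Z))) *: Q u%:Z.
    rewrite scaler_sumr -(@sum_window _ _ (fun u => (phi * C (u - (S + x%:Z))) *: Q u)
       (S + x%:Z) B B) //.
    - apply: eq_bigr => i _; rewrite scalerA /Q.
      by congr ((_ * C _) *: (_ * PY _)); lia.
    - by move=> u u0; rewrite Q0 ?scaler0.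
    - by move=> u u0; rewrite QB ?scaler0.
    - by move=> u u0; rewrite Cn ?mulr0 ?scale0r //; lia.
    - by move=> u u0; rewrite /Q PYn ?mulr0 ?scaler0 //; lia.
  have -> : phi' *: (\sum_(0 <= i < B) C' i%:Z *:
      (PY (T - g + y%:Z + i%:Z) * PX (S + g + x%:Z - i%:Z)))
     = \sum_(0 <= u < B) (phi' * C' (g - (u%:Z - (S + x%:Z)))) *: Q u%:Z.
    rewrite scaler_sumr -(@sum_window_rev _ _
       (fun u => (phi' * C' (g - (u - (S + x%:Z)))) *: Q u) (S + g + x%:Z) B B) //.
    - apply: eq_bigr => i _; rewrite scalerA /Q mulrC.
      by rewrite [X in _ *: X]mulrC [_ * phi']mulrC; congr ((_ * C' _) *: (_ * PY _)); lia.
    - by move=> u u0; rewrite Q0 ?scaler0.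
    - by move=> u u0; rewrite QB ?scaler0.
    - by move=> u u0; rewrite C'n ?mulr0 ?scale0r //; lia.
    - by move=> u u0; rewrite Q0 ?scaler0 //; lia.
  rewrite -big_split /= !scaler_sumr; apply: eq_bigr => u _.
  rewrite -scalerDl hphi !scalerA; congr (_ *: _).
  have -> : u%:Z - (S + x%:Z) = - x%:Z + - S + u%:Z by lia.
  by rewrite !zetaD; ring.
transitivity ((lam * zeta (- S)) *: \sum_(0 <= x < W) \sum_(0 <= y < W)
   PZ (S + T + x%:Z + y%:Z) * (zeta (- x%:Z) *: EX x%:Z (EY y%:Z v))).
  by rewrite scaler_sumr; apply: eq_bigr => x _; rewrite scaler_sumr.
rewrite -[RHS]scaler_sumr; congr (_ *: _).
pose f (x y : int) := PZ (S + T + x + y) * (zeta (- x) *: EX x (EY y v)).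
have EYn y : y < 0 -> EY y v = 0 by apply: (proj1 (hEY v)).
have EXl x : EX x 0 = 0.
  by have [L ->] := linear_pack (exp_seq_is_linear hEX EX0 x); rewrite linear0.
apply: etrans (sum_square (f := f) _ _ _) _.
- by move=> x y h; rewrite /f EYn // EXl scaler0 mulr0.
- by move=> x y h; rewrite /f hx // scaler0 mulr0.
- by move=> x y h; rewrite /f hy // scaler0 mulr0.
apply: eq_big_nat => l /andP[_ lW].
rewrite (annihilation_prod _ (B := (W + W)%N)) ?mulr_sumr //.
by apply: eq_bigr => x _; rewrite /f; congr (PZ _ * _); lia.
Qed.

End Ope.
End Vertex.

(** * Vertex operators from families of modes *)

Section ExpzExt.
Variables (K : numFieldType) (V : lmodType K).

Lemma exp_pow_ext (y z : nat -> V -> V) p r m :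
  (forall n v, (0 < n)%N -> y n v = z n v) -> exp_pow y p r m = exp_pow z p r m.
Proof.
move=> h; elim: r m => // r IH m; rewrite /exp_pow !iterS.
by apply: eq_big_nat => n /andP[n1 _]; rewrite h //; congr z; exact: IH.
Qed.

Lemma expz_ext (y z : nat -> V -> V) p m :
  (forall n v, (0 < n)%N -> y n v = z n v) -> expz y p m = expz z p m.
Proof.
move=> h; case: m => //= m; apply: eq_bigr => r _.
by rewrite (exp_pow_ext _ _ _ h).
Qed.

End ExpzExt.

Section VertexExpz.
Variables (K : numFieldType) (A : comAlgType K).
Variables (c : nat -> A) (d : nat -> {linear A -> A}).
Hypothesis dC : forall n k v, (0 < n)%N -> (0 < k)%N -> d n (d k v) = d k (d n v).

Definition creation_exp : int -> A := expz (fun n => mulop (c n)) 1.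
Definition annihilation_exp (m : int) (v : A) : A := expz d v m.

Lemma mulopC n k (v : A) : (0 < n)%N -> (0 < k)%N ->
  mulop (c n) (mulop (c k) v) = mulop (c k) (mulop (c n) v).
Proof. by rewrite /mulop mulrCA. Qed.

Lemma vertex_expz : vertex c d creation_exp annihilation_exp.
Proof.
split.
- exact: exp_coefP mulopC 1.
- exact: expz0.
- by move=> v; exact: exp_coefP dC v.
- by move=> v; exact: expz0.
Qed.

Lemma expz_mulop p m : expz (fun n => mulop (c n)) p m = creation_exp m * p.
Proof.
move: m; apply: exp_seq_uniq (exp_coefP mulopC p) (exp_seq_mulr _ (exp_coefP mulopC 1)) _.
by rewrite expz0 /creation_exp expz0 mul1r.
Qed.

End VertexExpz.

(** * Modes and normally ordered exponentials on the Fock space *)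

Section FsumWindow.
Variables (K : numFieldType) (V : zmodType).

(** The pairs of degrees in the sum that defines a coefficient of a vertex
    operator are parametrized by the annihilation degree x alone, the creation
    degree being S + x. *)
Lemma fsum_window (G : nat -> int -> V) (h s : K) (S : int) (W : nat) :
  s - h = S%:~R -> (forall x m, (W <= x)%N -> G x m = 0) ->
  (forall x (m : int), m < 0 -> G x m = 0) ->
  \sum_(d \in [set d : nat * nat | h + d.2%:R - d.1%:R = s]%classic) G d.1 d.2%:Z =
  \sum_(0 <= x < W) G x (S + x%:Z).
Proof.
move=> hS GW Gn.
have key (a b : nat) : h + b%:R - a%:R = s <-> b%:Z = S + a%:Z.
  have -> : s = S%:~R + h by rewrite -hS subrK.
  split=> [/eqP|hb].
    rewrite subr_eq [_ + h]addrC -addrA => /eqP/addrI/eqP.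
    rewrite -[b%:R]/(b%:~R) -[a%:R]/(a%:~R : K) -intrD eqr_int => /eqP; lia.
  have -> : b%:R = (S + a%:Z)%:~R :> K by rewrite -hb.
  by rewrite intrD -[a%:~R]/(a%:R : K); ring.
pose r := [seq (x, `|(S + x%:Z)%R|%N) | x <- [seq x <- index_iota 0 W | 0 <= S + x%:Z]].
rewrite (fsbigE r).
- rewrite big_map big_filter_cond /=.
  rewrite [RHS](bigID (fun x => 0 <= S + x%:Z)) /= [X in _ = _ + X]big1 ?addr0; last first.
    by move=> x h0; rewrite Gn //; lia.
  apply: eq_big => x.
    case: (boolP (0 <= S + x%:Z)) => h0; rewrite /= ?andbT ?andbF //.
    by apply/mem_set => /=; apply/key; lia.
  by move=> h0; congr G; lia.
- rewrite map_inj_uniq ?filter_uniq ?iota_uniq // => x y; by case.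
- move=> [a b] /= /mapP[x]; rewrite mem_filter => /andP[x0 _] [-> ->].
  by apply/key; lia.
- move=> [a b] /= /key hb hr; have [aW|Wa] := ltnP a W; last exact: GW.
  exfalso; move/negP: hr; apply; apply/mapP; exists a; last by congr pair; lia.
  by rewrite mem_filter mem_index_iota; apply/andP; split; lia.
Qed.

End FsumWindow.

Section LinearForms.
Variables (S : comNzRingType) (I : choiceType) (J : finType).
Local Notation F := {malg S[{cmonom I}]}.

Definition lin_creation (e : J -> I) (b : J -> S) : F := \sum_j b j *: << ucm (e j) >>.
Definition lin_annihilation (e : J -> I) (a : J -> S) (v : F) : F := \sum_j a j *: mderiv (e j) v.

Lemma lin_annihilation_is_linear e a : linear (lin_annihilation e a).
Proof.
move=> t u v; rewrite /lin_annihilation scaler_sumr -big_split /=; apply: eq_bigr => j _.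
rewrite (mderiv_is_linear (e j) t u v) scalerDr !scalerA.
by rewrite [a j * t]mulrC.
Qed.

HB.instance Definition _ e a :=
  GRing.isLinear.Build S F F *:%R (lin_annihilation e a) (lin_annihilation_is_linear e a).

Lemma lin_annihilationC e a e' a' v :
  lin_annihilation e a (lin_annihilation e' a' v) =
    lin_annihilation e' a' (lin_annihilation e a v).
Proof.
have main f b f' b' : lin_annihilation f b (lin_annihilation f' b' v) =
    \sum_j \sum_i (b j * b' i) *: mderiv (f j) (mderiv (f' i) v).
  apply: eq_bigr => j _; rewrite (linear_sum (mderiv (f j))) scaler_sumr.
  apply: eq_bigr => i _; rewrite -scalerA.
  exact: (congr1 ( *:%R _) (linearZ _ _)).
apply: etrans (main e a e' a') (esym (etrans (main e' a' e a) _)).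
apply: etrans (exchange_big _ _ _ _ _ _) _.
apply: eq_bigr => j _; apply: eq_bigr => i _.
exact: (congr2 *:%R (mulrC _ _) (mderivC _ _ _)).
Qed.

Lemma lin_annihilation_var e a x v : lin_annihilation e a (<< ucm x >> * v) =
  << ucm x >> * lin_annihilation e a v + (\sum_j a j * (e j == x)%:R) *: v.
Proof.
rewrite /lin_annihilation mulr_sumr scaler_suml -big_split /=; apply: eq_bigr => j _.
rewrite -(scalerAr (a j)) -scalerA -scalerDr addrC; congr (_ *: _).
exact: mderiv_var.
Qed.

Lemma lin_annihilation_creation e a e' b v : lin_annihilation e a (lin_creation e' b * v) =
  lin_creation e' b * lin_annihilation e a v +
    (\sum_i \sum_j b i * (a j * (e j == e' i)%:R)) *: v.
Proof.
rewrite /lin_creation !mulr_suml scaler_suml -big_split /= linear_sum.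
apply: eq_bigr => i _; rewrite -(scalerAl (b i) << ucm (e' i) >> v).
apply: etrans (linearZ_LR (lin_annihilation e a) (b i) _) _.
apply: etrans (congr1 ( *:%R (b i)) (lin_annihilation_var e a (e' i) v)) _.
by rewrite scalerDr scalerA mulr_sumr scalerAl.
Qed.

End LinearForms.

Section Modes.
Variables (R : realType) (lq : R[i]) (k : 'I_3 -> R[i]).
Local Notation K := (R[i]).
Local Notation F := {malg R[i][{cmonom ('I_4 * nat)%type}]}.
Implicit Types (X Y : field R) (v : F).

(** The variable with index (j, n - 1) stands for a_{j,-n}. *)
Definition modevar (n : nat) (j : 'I_4) : 'I_4 * nat := (j, n.-1).

(** The scalar [a_{i,n}, a_{j,-n}]. *)
Definition comm_coef (i j : 'I_4) (n : nat) : K :=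
  n%:R * qnum lq (cpl k i j * n%:R) / qnum lq n%:R.

Definition creation_mode X (n : nat) : F := lin_creation (modevar n) (fun j => fosc X j (- n%:Z)).

Definition annihilation_mode X (n : nat) : {linear F -> F} :=
  lin_annihilation (modevar n) (fun j => \sum_(i < 4) fosc X i n%:Z * comm_coef i j n).

(** The scalar [X_n, Y_{-n}]. *)
Definition osc_pairing X Y (n : nat) : K :=
  \sum_(j < 4) fosc Y j (- n%:Z) * \sum_(i < 4) fosc X i n%:Z * comm_coef i j n.

Lemma pder_mderiv x v : pder x v = mderiv x v.
Proof. by rewrite /mderiv unlock. Qed.

Lemma field_mode_cre X n v : (0 < n)%N ->
  field_mode lq k X (- n%:Z) v = mulop (creation_mode X n) v.
Proof.
case: n => // n _; rewrite /mulop /creation_mode /lin_creation mulr_suml.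
by apply: eq_bigr => i _; exact: scalerAl.
Qed.

Lemma field_mode_ann X n v : (0 < n)%N -> field_mode lq k X n%:Z v = annihilation_mode X n v.
Proof.
move=> n0; rewrite /field_mode /= /lin_annihilation.
transitivity (\sum_(i < 4) \sum_(j < 4) (fosc X i n%:Z * comm_coef i j n) *:
   mderiv (modevar n j) v).
  apply: eq_bigr => i _; rewrite scaler_sumr; apply: eq_bigr => j _.
  by rewrite scalerA; apply: (congr1 ( *:%R _)); exact: pder_mderiv.
by rewrite exchange_big /=; apply: eq_bigr => j _; rewrite scaler_suml.
Qed.

Lemma contraction_fields X Y : contraction (annihilation_mode X) (creation_mode Y)
  (osc_pairing X Y).
Proof.
move=> n m v n0 m0; apply: etrans (lin_annihilation_creation _ _ _ _ _) _.
apply: (congr1 (fun t => _ + t *: v)).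
rewrite /osc_pairing; have [mn|mn] := eqVneq m n.
  apply: eq_bigr => j _; rewrite (bigD1 j) //= /modevar mn eqxx mulr1.
  rewrite [X in _ + X]big1 ?addr0 // => i ij; by rewrite xpair_eqE (negbTE ij) /= mulr0n !mulr0.
apply: (@big1 K 0 +%R) => i _; apply: (@big1 K 0 +%R) => j _.
suff -> : (modevar n j == modevar m i) = false by rewrite mulr0n !mulr0.
rewrite xpair_eqE; apply/negbTE; rewrite negb_and; apply/orP; right.
by apply: contra_neq mn; lia.
Qed.

Lemma annihilation_modeC X Y n m v : (0 < n)%N -> (0 < m)%N ->
  annihilation_mode X n (annihilation_mode Y m v) =
    annihilation_mode Y m (annihilation_mode X n v).
Proof. by move=> _ _; exact: lin_annihilationC. Qed.

Definition creation_part X : int -> F := creation_exp (creation_mode X).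
Definition annihilation_part X : int -> F -> F := annihilation_exp (annihilation_mode X).

Lemma vertex_field X : vertex (creation_mode X) (annihilation_mode X) (creation_part X)
  (annihilation_part X).
Proof. by apply: vertex_expz => n m v; exact: annihilation_modeC. Qed.

Lemma exp_coef_cre X p (m : nat) :
  exp_coef (fun n => field_mode lq k X (- n%:Z)) p m = creation_part X m%:Z * p.
Proof.
rewrite /creation_part -expz_mulop -(expz_ext _ _ (fun n v => @field_mode_cre X n v)).
by [].
Qed.

Lemma exp_coef_ann X p (m : nat) :
  exp_coef (fun n => field_mode lq k X n%:Z) p m = annihilation_part X m%:Z p.
Proof.
rewrite /annihilation_part /annihilation_exp -(expz_ext _ _ (fun n v => @field_mode_ann X n v)).
by [].
Qed.

Lemma annihilation_part_is_linear X m : linear (annihilation_part X m).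
Proof.
have [_ _ h h0] := vertex_field X; exact: exp_seq_is_linear h h0 m.
Qed.

Lemma annihilation_partC X Y x y v : annihilation_part X x (annihilation_part Y y v) =
  annihilation_part Y y (annihilation_part X x v).
Proof.
apply: (vertex_comm x y v (vertex_field X) (vertex_field Y)) => n m u.
exact: annihilation_modeC.
Qed.

(** By induction on the polynomial: a constant is killed in all positive
    degrees, and multiplying by a_{i,-(n+1)} lengthens the exponential by at
    most n + 1, since E_x then only picks up a multiple of E_(x-n-1). *)
Lemma annihilation_part_nilp X v : exists W : nat, forall x : int,
  W%:Z <= x -> annihilation_part X x v = 0.
Proof.
have [_ _ hE E0] := vertex_field X.
elim/malg_var_ind: v => [|a u v [Wu hu] [Wv hv]|[i n] v [W hW]].
- exists 1%N; suff H : annihilation_part X^~ 1 =1 (fun m => if m == 0 then 1 else 0).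
    by move=> x x1; rewrite H ifF //; lia.
  apply: exp_seq_uniq (hE 1) _ _; last by rewrite E0.
  apply: exp_seq_intro => [m m0|m m0]; first by rewrite ifF //; lia.
  exists `|m|.+1; first lia.
  have [->|mn] := eqVneq m 0; first by rewrite scale0r big_geq.
  rewrite scaler0; apply: esym; apply: big1 => j _.
  case: eqP => _; last by rewrite linear0 scaler0.
  have -> : annihilation_mode X j 1 = 0 by apply: big1 => ? _; rewrite mderiv1 scaler0.
  by rewrite scaler0.
- exists (maxn Wu Wv) => x hx; rewrite annihilation_part_is_linear hu ?hv ?scaler0 ?addr0 //; lia.
exists (W + n.+1)%N => x hx.
(* Multiplication by a variable is the operator, and the annihilation modes are the exponent. *)
pose c := - (\sum_(i0 < 4) fosc X i0 n.+1%:Z * comm_coef i0 i n.+1).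
have hD m u : (0 < m)%N -> mulop << ucm (i, n) >> (annihilation_mode X m u) =
   annihilation_mode X m (mulop << ucm (i, n) >> u) + (if m == n.+1 then c else 0) *: u.
  move=> m0; apply: esym.
  rewrite [X in X + _](lin_annihilation_var (modevar m) _ (i, n) u) -addrA -scalerDl.
  rewrite [X in X *: _](_ : _ = 0) ?scale0r ?addr0 //.
  have [mn|mn] := eqVneq m n.+1.
    rewrite (bigD1 i) //= /modevar mn eqxx mulr1 [X in _ + X + _]big1 ?addr0 ?subrr // => j ij.
    by rewrite xpair_eqE (negbTE ij) mulr0.
  rewrite addr0 big1 // => j _; rewrite xpair_eqE.
  suff -> : (m.-1 == n) = false by rewrite andbF mulr0.
  by apply/negbTE; apply: contra_neq mn; lia.
have := exp_seq_commutator (ltn0Sn n) hD (hE v) (hE (<< ucm (i, n) >> * v)) _ x.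
rewrite !E0 => /(_ erefl).
rewrite !hW ?linear0 ?scaler0 ?addr0 //; lia.
Qed.

Lemma annihilation_part_nilp2 X Y v : exists W : nat,
  (forall x y : int, W%:Z <= x -> annihilation_part X x (annihilation_part Y y v) = 0) /\
  (forall x y : int, W%:Z <= y -> annihilation_part X x (annihilation_part Y y v) = 0).
Proof.
have E0 Z x : annihilation_part Z x 0 = 0.
  by have [L ->] := linear_pack (@annihilation_part_is_linear Z x); rewrite linear0.
have [W1 h1] := annihilation_part_nilp X v; have [W2 h2] := annihilation_part_nilp Y v.
exists (maxn W1 W2); split=> x y h; last by rewrite h2 ?E0 //; lia.
by rewrite annihilation_partC h1 ?E0 //; lia.
Qed.

(** The exponent h of the factor z^h by which the zero modes act. *)
Definition log_exponent X (b : momentum R) : K := \sum_(i < 4) flog X i * zeromode k i b.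
(** The constant factor that comes from the shifts of the argument in the zero
    modes. *)
Definition zero_mode_phase X (b : momentum R) : K :=
  cexp (\sum_(i < 4) fcst X i * zeromode k i b).

(** Only when s - h is an integer S does :e^{X(z)}: have a coefficient of z^s
    on the sector b. *)
Lemma normexpE X b s p (S : int) (W : nat) : s - log_exponent X b = S%:~R ->
  (forall x : int, W%:Z <= x -> annihilation_part X x p = 0) ->
  normexp lq k X b s p =
    zero_mode_phase X b *: vertex_coef (creation_part X) (annihilation_part X) S W p.
Proof.
move=> hS hW; apply: (congr1 ( *:%R _)).
pose G (x : nat) (m : int) : F := creation_part X m * annihilation_part X x%:Z p.
rewrite /vertex_coef -(@fsum_window _ _ G _ _ _ _ hS).
- apply: eq_fsbigr => -[a b'] _ /=; rewrite exp_coef_cre exp_coef_ann //.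
- by move=> x m h; rewrite /G hW ?mulr0 //; lia.
move=> x m m0; have [[P0 _] _ _ _] := vertex_field X.
by rewrite /G P0 ?mul0r.
Qed.

End Modes.

(** * Powers of q, shifts of the argument, and exchange of vertex operators *)

Section Cexp.
Variables (R : realType).
Implicit Types (x y z lq : R[i]).

Lemma cexpD x y : cexp (x + y) = cexp x * cexp y.
Proof.
case: x y => [a b] [c d]; rewrite /cexp /= expRD cosD sinD.
by apply/eqP; rewrite eq_complex /=; apply/andP; split; apply/eqP; ring.
Qed.

Lemma cexp0 : cexp (0 : R[i]) = 1.
Proof. by rewrite /cexp /= expR0 cos0 sin0 mulr1 mulr0. Qed.

Lemma cexp_neq0 x : cexp x != 0.
Proof.
apply/eqP => h; have := cexpD x (- x).
by rewrite subrr cexp0 h mul0r; apply/eqP; rewrite oner_eq0.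
Qed.

Lemma qpowD lq x y : qpow lq (x + y) = qpow lq x * qpow lq y.
Proof. by rewrite /qpow mulrDl cexpD. Qed.

Lemma qpow0 lq : qpow lq 0 = 1. Proof. by rewrite /qpow mul0r cexp0. Qed.

Lemma qpow_neq0 lq x : qpow lq x != 0. Proof. exact: cexp_neq0. Qed.

Lemma qpowN lq x : qpow lq (- x) = (qpow lq x)^-1.
Proof.
apply: (mulfI (qpow_neq0 lq x)).
by rewrite -qpowD subrr qpow0 divff // qpow_neq0.
Qed.

Lemma qpow_nat lq (n : nat) : qpow lq n%:R = cexp lq ^+ n.
Proof.
elim: n => [|n IH]; first by rewrite qpow0.
by rewrite mulrSr qpowD IH /qpow mul1r exprSr.
Qed.

(** q is not a root of unity. *)
Lemma qpow_nat_sub lq (n : nat) : `|cexp lq| < 1 -> (0 < n)%N ->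
  qpow lq n%:R - (qpow lq n%:R)^-1 != 0.
Proof.
move=> hq n0; rewrite subr_eq0; apply/eqP => h.
have : qpow lq n%:R ^+ 2 = 1 by rewrite expr2 {1}h mulVf // qpow_neq0.
rewrite qpow_nat -exprM => /(congr1 Num.norm); rewrite normrX normr1 => /eqP.
rewrite pexpr_eq1 ?normr_ge0 //; last by rewrite muln_gt0 n0.
by move=> /eqP h1; rewrite h1 ltxx in hq.
Qed.

End Cexp.

Section Scale2.
Variables (K : numFieldType) (V : lmodType K).

Lemma scale2 (a c d e : K) (v : V) : a * c = d * e -> a *: (c *: v) = d *: (e *: v).
Proof. by move=> h; rewrite !scalerA h. Qed.

Lemma scale3 (a x y e d f : K) (u v w : V) : x *: u + (e * y) *: v = d *: w ->
  a * d = f -> a *: (x *: u) + e *: (a *: (y *: v)) = f *: w.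
Proof.
move=> h <-; rewrite -scalerA -h scalerDr; congr (_ + _).
by rewrite !scalerA; congr (_ *: _); ring.
Qed.

End Scale2.

Section Ope.
Variables (R : realType) (lq : R[i]) (k : 'I_3 -> R[i]).
Local Notation K := (R[i]).
Local Notation F := {malg R[i][{cmonom ('I_4 * nat)%type}]}.
Implicit Types (X Y : field R) (b c : momentum R).
Local Notation hlog := (log_exponent k).
Local Notation phase := (zero_mode_phase k).
Local Notation creX := creation_part.
Local Notation annX := (annihilation_part lq k).
Local Notation kappa := (osc_pairing lq k).

Lemma zeromodeD i b c : zeromode k i (b + c) = zeromode k i b + zeromode k i c.
Proof. by rewrite -big_split; apply: eq_bigr => j _; rewrite mxE mulrDl. Qed.

Lemma hlogD X b c : hlog X (b + c) = hlog X b + hlog X c.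
Proof. by rewrite -big_split; apply: eq_bigr => j _; rewrite zeromodeD mulrDr. Qed.

Lemma phaseD X b c : phase X (b + c) = phase X b * phase X c.
Proof.
rewrite /phase -cexpD -big_split; congr cexp; apply: eq_bigr => j _.
by rewrite zeromodeD mulrDr.
Qed.

Lemma vertex_coefZ X (S : int) (W : nat) (a : K) (p : F) :
  vertex_coef (creX X) (annX X) S W (a *: p) = a *: vertex_coef (creX X) (annX X) S W p.
Proof.
rewrite /vertex_coef scaler_sumr; apply: eq_bigr => x _.
have [L ->] := linear_pack (@annihilation_part_is_linear _ lq k X x%:Z).
by rewrite scalerAr (linearZ_LR L).
Qed.

(** The field X(q^s z). *)
Definition shift_field (s : K) X : field R :=
  Field (fQ X) (flog X) (fun i => fcst X i + s * lq * flog X i)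
    (fun i n => fosc X i n * qpow lq (- s * n%:~R)).

Lemma hlog_shift s X b : hlog (shift_field s X) b = hlog X b. Proof. by []. Qed.

Lemma phase_shift s X b : phase (shift_field s X) b = qpow lq (s * hlog X b) * phase X b.
Proof.
rewrite /qpow -cexpD; congr cexp; rewrite mulr_sumr mulr_suml -big_split.
by apply: eq_bigr => i _ /=; ring.
Qed.

Let qz s (m : int) := qpow lq (s * m%:~R).

Lemma qzD s m n : qz s (m + n) = qz s m * qz s n.
Proof. by rewrite /qz intrD mulrDr qpowD. Qed.

Lemma creation_mode_shift s X n (v : F) : creation_mode (shift_field s X) n * v =
  qz s n%:Z *: (creation_mode X n * v).
Proof.
rewrite scalerAl; apply: (congr1 (fun u => u * v));
  rewrite /creation_mode /lin_creation scaler_sumr.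
apply: eq_bigr => i _; rewrite scalerA /=; apply: (congr1 (fun u => u *: _)).
by rewrite mulrC /qz; congr (qpow lq _ * _); rewrite rmorphN; ring.
Qed.

Lemma annihilation_mode_shift s X n (v : F) : annihilation_mode lq k (shift_field s X) n v
  = qz s (- n%:Z) *: annihilation_mode lq k X n v.
Proof.
rewrite [RHS]scaler_sumr; apply: eq_bigr => i _; rewrite scalerA mulr_sumr.
apply: (congr1 (fun u => u *: _)); apply: eq_bigr => j _ /=.
rewrite mulrA; congr (_ * _); rewrite mulrC /qz; congr (qpow lq _ * _).
by rewrite rmorphN; ring.
Qed.

Lemma creation_mode_add X Y n (v : F) : creation_mode (fieldD X Y) n * v =
  creation_mode X n * v + creation_mode Y n * v.
Proof.
rewrite -mulrDl; apply: (congr1 (fun u => u * v));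
  rewrite /creation_mode /lin_creation -big_split.
by apply: eq_bigr => i _; rewrite /= scalerDl.
Qed.

Lemma annihilation_mode_add X Y n (v : F) :
  annihilation_mode lq k (fieldD X Y) n v = annihilation_mode lq k X n v +
    annihilation_mode lq k Y n v.
Proof.
rewrite -[RHS]big_split; apply: eq_bigr => i _; rewrite -[RHS]scalerDl.
apply: (congr1 (fun u => u *: _)); rewrite -big_split; apply: eq_bigr => j _.
by rewrite /= mulrDl.
Qed.

Lemma creation_part_shift s X m : creX (shift_field s X) m = qz s m *: creX X m.
Proof.
have [h h1 _ _] := vertex_field lq k (shift_field s X).
have [g g1 _ _] := vertex_field lq k X.
move: m; apply: exp_seq_uniq h _ _; last by rewrite h1 g1 /qz mulr0 qpow0 scale1r.
by apply: exp_seq_scale (@qzD s) _ g => n v n0; exact: creation_mode_shift.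
Qed.

Lemma annihilation_part_shift s X m v : annX (shift_field s X) m v = qz s (- m) *: annX X m v.
Proof.
have [_ _ h h1] := vertex_field lq k (shift_field s X).
have [_ _ g g1] := vertex_field lq k X.
have qzN (i j : int) : qz s (- (i + j)) = qz s (- i) * qz s (- j).
  by rewrite opprD qzD.
move: m; apply: exp_seq_uniq (h v) _ _.
  by apply: exp_seq_scale qzN _ (g v) => n u n0; exact: annihilation_mode_shift.
by rewrite h1 g1 oppr0 /qz mulr0 qpow0 scale1r.
Qed.

(** The coefficient of z^t in a series in q^s z picks up q^{st}. In particular
    the coefficient of z^0, the one that matters for the bosonic screening
    operators, is invariant. *)
Lemma normexp_shift s X b t (S : int) p : t - hlog X b = S%:~R ->
  normexp lq k (shift_field s X) b t p = qpow lq (s * t) *: normexp lq k X b t p.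
Proof.
move=> hS; have [W hW] := annihilation_part_nilp lq k X p.
rewrite (normexpE hS hW) (normexpE (X := shift_field s X) hS (W := W)); last first.
  by move=> x xW; rewrite annihilation_part_shift hW // scaler0.
have -> : t = hlog X b + S%:~R by rewrite -hS addrC subrK.
rewrite phase_shift [RHS]scalerA mulrDr qpowD.
rewrite [X in _ = X *: _](_ : _ = (qpow lq (s * hlog X b) * phase X b) * qz s S); last first.
  by rewrite /qz; ring.
rewrite -[RHS]scalerA; apply: (congr1 ( *:%R _)).
rewrite /vertex_coef [RHS]scaler_sumr; apply: eq_bigr => x _.
rewrite creation_part_shift annihilation_part_shift -scalerAr -scalerAl scalerA.
apply: (congr1 (fun u : K => u *: _)).
by rewrite -qzD; apply: (congr1 (qz s)); lia.
Qed.

(** [vertex_exchange] with the zero modes put back. The integer g is the power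
    of z in the contraction, the same for both orders, and the phases of X and
    Y at the momenta of Y and X are the constant factors of the two products;
    they come from moving the zero modes of one field past the momentum of the
    other. For eps = 1 this is an anticommutator, for eps = -1 a commutator. *)
Lemma normexp_exchange X Y b (s t s0 lam eps : K) (g S T : int) (C C' : int -> K) p :
  s - hlog X b = (S + g)%:~R -> t - hlog Y b = T%:~R ->
  hlog X (field_mom Y) = g%:~R -> hlog Y (field_mom X) = g%:~R ->
  scalar_exp (kappa X Y) C -> scalar_exp (kappa Y X) C' ->
  (forall i : int, phase X (field_mom Y) * C i +
     eps * phase Y (field_mom X) * C' (g - i) = lam * qpow lq (s0 * i%:~R)) ->
  normexp lq k X (b + field_mom Y) s (normexp lq k Y b t p) +
  eps *: normexp lq k Y (b + field_mom X) t (normexp lq k X b s p) =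
  (lam * qpow lq (s0 * (g%:~R - s))) *:
    normexp lq k (fieldD (shift_field s0 X) Y) b (s + t - g%:~R) p.
Proof.
move=> hX hY gXY gYX hC hC' hl.
set Z := fieldD (shift_field s0 X) Y.
have [W0 [hx0 hy0]] := annihilation_part_nilp2 lq k X Y p.
have [WZ hZ] := annihilation_part_nilp lq k Z p.
have [WX hX0] := annihilation_part_nilp lq k X p.
have [WY hY0] := annihilation_part_nilp lq k Y p.
(* One cut-off that serves all the exponentials in the statement. *)
pose W := (W0 + WZ + WX + WY)%N.
have hx x y : W%:Z <= x -> annX X x (annX Y y p) = 0 by move=> h; apply: hx0; lia.
have hy x y : W%:Z <= y -> annX X x (annX Y y p) = 0 by move=> h; apply: hy0; lia.
have [N hN] := @vertex_exchange K F (creation_mode X) (creation_mode Y) (creation_mode Z)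
  (annihilation_mode lq k X) (annihilation_mode lq k Y) (annihilation_mode lq k Z)
  (creX X) (creX Y) (creX Z) (annX X) (annX Y) (annX Z) (kappa X Y) (kappa Y X) C C'
  (qz s0) (vertex_field _ _ _) (vertex_field _ _ _) (vertex_field _ _ _)
  (@annihilation_modeC _ _ _ _ _) (contraction_fields _ _ _ _) (contraction_fields _ _ _ _)
    hC hC' 
  (etrans (congr1 (qpow lq) (mulr0 s0)) (qpow0 lq)) (@qzD s0) 
  (fun n v _ => etrans (creation_mode_add _ _ _ _) (congr1 (+%R^~ _) (creation_mode_shift
    s0 X n v)))
  (fun n v _ => etrans (annihilation_mode_add _ _ _ _) (congr1 (+%R^~ _)
    (annihilation_mode_shift s0 X n v)))
  _ _ _ g S T W p hl hx hy.
set pX := phase X b; set pY := phase Y b.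
have eY : normexp lq k Y b t p = pY *: vertex_coef (creX Y) (annX Y) T W p.
  by apply: normexpE hY _ => x h; apply: hY0; lia.
have eX : normexp lq k X b s p = pX *: vertex_coef (creX X) (annX X) (S + g) W p.
  by apply: normexpE hX _ => x h; apply: hX0; lia.
have hXY : s - hlog X (b + field_mom Y) = S%:~R.
  by rewrite hlogD gXY opprD addrA hX intrD addrK.
have hYX : t - hlog Y (b + field_mom X) = (T - g)%:~R.
  by rewrite hlogD gYX opprD addrA hY intrB.
have [W1 h1] := annihilation_part_nilp lq k X (normexp lq k Y b t p).
have [W2 h2] := annihilation_part_nilp lq k Y (normexp lq k X b s p).
have -> : normexp lq k X (b + field_mom Y) s (normexp lq k Y b t p) =
    (pX * pY) *: (phase X (field_mom Y) *:
      vertex_coef (creX X) (annX X) S (N + W1) (vertex_coef (creX Y) (annX Y) T W p)).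
  apply: etrans (normexpE hXY (W := (N + W1)%N) _) _.
    by move=> x h; apply: h1; lia.
  apply: etrans (congr1 (fun u => _ *: vertex_coef _ _ _ _ u) eY) _.
  apply: etrans (congr1 ( *:%R _) (vertex_coefZ _ _ _ _ _)) _.
  by apply: scale2; rewrite phaseD /pX /pY; ring.
have -> : normexp lq k Y (b + field_mom X) t (normexp lq k X b s p) =
    (pX * pY) *: (phase Y (field_mom X) *:
      vertex_coef (creX Y) (annX Y) (T - g) (N + W2)
        (vertex_coef (creX X) (annX X) (S + g) W p)).
  apply: etrans (normexpE hYX (W := (N + W2)%N) _) _.
    by move=> x h; apply: h2; lia.
  apply: etrans (congr1 (fun u => _ *: vertex_coef _ _ _ _ u) eX) _.
  apply: etrans (congr1 ( *:%R _) (vertex_coefZ _ _ _ _ _)) _.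
  by apply: scale2; rewrite phaseD /pX /pY; ring.
have hlZ : hlog Z b = hlog X b + hlog Y b.
  by rewrite -big_split; apply: eq_bigr => i _; rewrite /= mulrDl.
have pZ : phase Z b = qpow lq (s0 * hlog X b) * (pX * pY).
  rewrite mulrA -phase_shift /phase -cexpD; congr cexp; rewrite -big_split.
  by apply: eq_bigr => i _; rewrite /= -mulrDl.
have SE : S%:~R = s - hlog X b - g%:~R by rewrite hX intrD addrK.
have hST : s + t - g%:~R - hlog Z b = (S + T)%:~R.
  by rewrite hlZ intrD SE -hY; ring.
have -> : normexp lq k Z b (s + t - g%:~R) p =
   phase Z b *: vertex_coef (creX Z) (annX Z) (S + T) (W + W) p.
  by apply: normexpE hST _ => x h; apply: hZ; lia.
rewrite [RHS]scalerA.
apply: scale3 (hN (N + W1)%N (N + W2)%N (leq_addr _ _) (leq_addr _ _)) _.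
rewrite pZ /qz.
have -> : (- S)%:~R = g%:~R - s + hlog X b :> K.
  by rewrite rmorphN /= SE; ring.
by rewrite mulrDr !qpowD; ring.
Qed.

End Ope.

(** * Rational contraction factors *)

Section ScalarExp.
Variables (K : numFieldType) (zeta : int -> K).
Hypothesis zeta0 : zeta 0 = 1.
Hypothesis zetaD : forall m n, zeta (m + n) = zeta m * zeta n.

Lemma scalar_exp_intro (kap : nat -> K) (C : int -> K) :
  (forall m : int, m < 0 -> C m = 0) -> C 0 = 1 ->
  (forall m : nat, (0 < m)%N ->
     m%:R * C m%:Z = \sum_(1 <= n < m.+1) n%:R * kap n * C (m%:Z - n%:Z)) ->
  scalar_exp kap C.
Proof.
move=> Cn C0 h; split=> //; apply: exp_seq_intro => // -[[|m]|m] // _.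
  by exists 1%N => //; rewrite big_geq // scale0r.
exists m.+2; first lia.
apply: etrans (h m.+1 isT) _; apply: eq_bigr => n _.
by rewrite -mulrA.
Qed.

Lemma scalar_exp_zero (kap : nat -> K) : (forall n, (0 < n)%N -> kap n = 0) ->
  scalar_exp kap (fun i => (i == 0)%:R).
Proof.
move=> h; apply: scalar_exp_intro => // [m m0|[|m] // _]; first by case: eqP => //; lia.
rewrite mulr0 big_nat_cond big1 // => n /andP[/andP[n0 _] _].
by rewrite h // mulr0 mul0r.
Qed.

(** C(t) = 1 - gamma t, with zeta i = gamma^i. *)
Lemma scalar_exp_lin (kap : nat -> K) :
  (forall n, (0 < n)%N -> kap n = - zeta n%:Z / n%:R) ->
  scalar_exp kap (fun i => if i == 0 then 1 else if i == 1 then - zeta 1 else 0).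
Proof.
move=> h; apply: scalar_exp_intro => // [m m0|m m0].
  by rewrite !ifF //; apply/negbTE; lia.
have e n : (0 < n)%N -> n%:R * kap n = - zeta n%:Z.
  by move=> n0; rewrite h // mulrCA divff ?mulr1 // pnatr_eq0; lia.
case: m m0 => // -[|m] _.
  by rewrite big_nat1 e // subrr eqxx /= mul1r mulr1.
rewrite big_nat_recr //= big_nat_recr //= big_nat_cond big1 => [|n /andP[/andP[n0 nm] _]];
  last first.
  by rewrite !ifF ?mulr0 //; apply/negbTE; lia.
have -> : m.+2%:Z - m.+2%:Z = 0 by lia.
have -> : m.+2%:Z - m.+1%:Z = 1 by lia.
rewrite !e //= add0r mulr1 mulrNN -zetaD.
have -> : m.+1%:Z + 1 = m.+2%:Z by lia.
by rewrite mulr0 subrr.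
Qed.

(** C(t) = 1/(1 - gamma t), with zeta i = gamma^i. *)
Lemma scalar_exp_geom (kap : nat -> K) :
  (forall n, (0 < n)%N -> kap n = zeta n%:Z / n%:R) ->
  scalar_exp kap (fun i => if 0 <= i then zeta i else 0).
Proof.
move=> h; apply: scalar_exp_intro => // [m m0|m m0].
  by rewrite ifF //; apply/negbTE; lia.
have e n : (0 < n)%N -> n%:R * kap n = zeta n%:Z.
  by move=> n0; rewrite h // mulrCA divff ?mulr1 // pnatr_eq0; lia.
rewrite (eq_big_nat _ _ (F2 := fun => zeta m%:Z)) => [|n /andP[n0 nm]].
  by rewrite sumr_const_nat subSS subn0 mulr_natl.
by rewrite e // ifT -?zetaD; [congr zeta; lia|lia].
Qed.

(** C(t) = (1 - r gamma t)/(1 - gamma t), with zeta i = gamma^i and rho i =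
    r^i. *)
Lemma scalar_exp_mobius (rho : int -> K) (kap : nat -> K) :
  (forall m n, rho (m + n) = rho m * rho n) ->
  (forall n, (0 < n)%N -> kap n = - (zeta n%:Z * rho n%:Z - zeta n%:Z) / n%:R) ->
  scalar_exp kap
    (fun i => if i == 0 then 1 else if 0 <= i then zeta i * (1 - rho 1) else 0).
Proof.
move=> rhoD h; apply: scalar_exp_intro => // [m m0|m m0].
  by rewrite !ifF //; apply/negbTE; lia.
have e n : (0 < n)%N -> n%:R * kap n = zeta n%:Z * (1 - rho n%:Z).
  move=> n0; rewrite h // mulrCA divff; last by rewrite pnatr_eq0; lia.
  by rewrite mulr1; ring.
case: m m0 => // m _; rewrite big_nat_recr //= e // subrr eqxx mulr1.
rewrite (eq_big_nat _ _ (F2 := fun n => zeta m.+1%:Z * ((1 - rho n%:Z) * (1 - rho 1)))).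
  rewrite -mulr_sumr mulrCA -mulrDr; congr (_ * _).
  elim: m => [|m IH]; first by rewrite big_geq // mul1r add0r.
  rewrite big_nat_recr //= mulrSr mulrDl mul1r IH.
  have -> : m.+2%:Z = m.+1%:Z + 1 by lia.
  by rewrite rhoD; ring.
move=> n /andP[n0 nm]; rewrite e // ifF; last by apply/negbTE; lia.
rewrite ifT; last lia.
have -> : zeta m.+1%:Z = zeta n%:Z * zeta (m.+1%:Z - n%:Z) by rewrite -zetaD; congr zeta; lia.
by ring.
Qed.

End ScalarExp.

(** * The couplings of the four bosons *)

Section Coupling.
Variables (R : realType) (k : 'I_3 -> R[i]).
Hypothesis hk : \sum_(i < 3) k i = - 4%:R.

(** 0 + 1 + 2 = 0 in Z/3. *)
Lemma third_label (a b c : 'I_3) : a != b -> a != c -> b != c -> - (a + b) = c.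
Proof.
by case: a b c => -[|[|[|//]]] ? [[|[|[|//]]] ?] [[|[|[|//]]] ?] // *; apply/val_inj.
Qed.

Lemma third_label_neq (a b : 'I_3) : a != b -> (a != - (a + b)) && (b != - (a + b)).
Proof. by case: a b => -[|[|[|//]]] ? [[|[|[|//]]] ?]. Qed.

Lemma sum_k3 (a b c : 'I_3) : a != b -> a != c -> b != c -> k a + k b + k c = - 4%:R.
Proof.
move=> ab ac bc; rewrite -hk (bigD1 a) //= (bigD1 b) /=; last by rewrite eq_sym.
rewrite (bigD1 c) /=; last by rewrite eq_sym ac eq_sym.
rewrite big1 ?addr0 ?addrA // => i /andP[/andP[ia ib] ic]; exfalso.
move: ab ac bc ia ib ic.
by case: a b c i => -[|[|[|//]]] ? [[|[|[|//]]] ?] [[|[|[|//]]] ?] [[|[|[|//]]] ?].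
Qed.

Lemma cplC (i j : 'I_4) : cpl k i j = cpl k j i.
Proof.
rewrite /cpl; case: (unlift ord0 i) => [a|]; case: (unlift ord0 j) => [b|] //.
by rewrite eq_sym [a + b]addrC.
Qed.

Lemma cplii i : cpl k i i = 1.
Proof. by rewrite /cpl; case: (unlift ord0 i) => [a|] //; rewrite eqxx. Qed.

(** Three distinct bosons are coupled by k_1 + 1, k_2 + 1 and k_3 + 1 in some
    order, and k_1 + k_2 + k_3 + 3 = -1. *)
Lemma cpl_triple (a b c : 'I_4) : a != b -> a != c -> b != c ->
  cpl k a b + cpl k a c + cpl k b c = - 1.
Proof.
suff H (x y : 'I_3) : x != y ->
    (k x + 1) + (k y + 1) + (k (- (x + y)) + 1) = - 1.
  rewrite /cpl.
  case: (unliftP ord0 a) => [a' ->|->]; case: (unliftP ord0 b) => [b' ->|->];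
  case: (unliftP ord0 c) => [c' ->|->]; rewrite ?(inj_eq lift_inj) ?eqxx // => ab ac bc.
  - rewrite (negbTE ab) (negbTE ac) (negbTE bc).
    have e2 : - (a' + c') = b' by apply: third_label; rewrite // eq_sym.
    have e3 : - (b' + c') = a' by apply: third_label; rewrite // eq_sym.
    by rewrite e2 e3 -(H _ _ ab); ring.
  - by rewrite (negbTE ab) -(H _ _ ab); ring.
  - by rewrite (negbTE ac) -(H _ _ ac); ring.
  by rewrite (negbTE bc) -(H _ _ bc); ring.
move=> xy; have /andP[h1 h2] := third_label_neq xy.
by have := sum_k3 xy h1 h2; move=> h; rewrite -[LHS](addrK (- 4%:R)) -{2}h; ring.
Qed.

(** The level c_ab + 1 attached to a pair of bosons is one of the k_l + 2,
    which genericity keeps away from the zeros of the q-numbers. *)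
Lemma cpl_generic (a b : 'I_4) : a != b -> exists l, cpl k a b + 1 = k l + 2%:R.
Proof.
rewrite /cpl; case: (unliftP ord0 a) => [a' ->|->]; case: (unliftP ord0 b) => [b' ->|->].
- rewrite (inj_eq lift_inj) => /negbTE ->; exists (- (a' + b')); ring.
- by move=> _; exists a'; ring.
- by move=> _; exists b'; ring.
by rewrite eqxx.
Qed.

Lemma bos_neq (a b : 'I_3) : (bos a == bos b) = (a == b).
Proof. exact: (inj_eq lift_inj). Qed.

Lemma bos_neq0 (a : 'I_3) : (ord0 == bos a) = false.
Proof. by apply/negbTE; exact: neq_lift. Qed.

(** The couplings are compatible with Q_{a_0} = - Q_{a_1} - Q_{a_2} - Q_{a_3}.
    *)
Lemma cpl_row0 (i : 'I_4) : - \sum_(j < 3) cpl k i (bos j) = cpl k i ord0.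
Proof.
have [->|i0] := eqVneq i ord0.
  rewrite cplii (eq_bigr (fun j => k j + 1)); last first.
    by move=> j _; rewrite /cpl unlift_none liftK.
  by rewrite big_split /= hk sumr_const card_ord; ring.
have [a ia|ia] := unliftP ord0 i; last by rewrite ia eqxx in i0.
have {ia} -> : i = bos a by [].
have n1 : a + 1 != a by case: a {i0} => -[|[|[|//]]].
have n2 : a + 2%:R != a by case: a {i0 n1} => -[|[|[|//]]].
have n12 : a + 2%:R != a + 1 by case: a {i0 n1 n2} => -[|[|[|//]]].
rewrite (bigD1 a) //= (bigD1 (a + 1)) //= (bigD1 (a + 2%:R)) /= ?n2 ?n12 //.
rewrite big1 ?addr0; last first.
  move=> j /andP[/andP[h1 h2] h3]; exfalso; move: h1 h2 h3.
  by case: a j {i0 n1 n2 n12} => -[|[|[|//]]] ? [[|[|[|//]]] ?].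
rewrite /cpl unlift_none !liftK eqxx eq_sym (negbTE n1) eq_sym (negbTE n2).
have m1 : a != a + 1 by rewrite eq_sym.
have m2 : a != a + 2%:R by rewrite eq_sym.
have m12 : a + 1 != a + 2%:R by rewrite eq_sym.
rewrite (third_label m1 m2 m12) (third_label m2 m1 n12).
have h := sum_k3 m1 m2 m12.
have -> : k a = - 4%:R - k (a + 1) - k (a + 2%:R) by rewrite -h; ring.
by ring.
Qed.

End Coupling.

(** * Contractions of the screening currents *)

Section Pick.
Variables (K : nzRingType) (n : nat).

Lemma sum_pick (j : 'I_n) (f g : 'I_n -> K) :
  \sum_(i < n) (if i == j then f i else 0) * g i = f j * g j.
Proof.
rewrite (bigD1 j) //= eqxx big1 ?addr0 // => i /negbTE ->.
by rewrite mul0r.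
Qed.

End Pick.

Section Fields.
Variables (R : realType) (lq : R[i]) (k : 'I_3 -> R[i]).
Local Notation K := (R[i]).
Implicit Types (X Y : field R) (a c : 'I_4) (b : momentum R) (s t N M e : K).
Hypothesis hq : `|cexp lq| < 1.
Hypothesis hk : \sum_(i < 3) k i = - 4%:R.
Hypothesis hgen : generic lq k.
Local Notation kappa := (osc_pairing lq k).
Local Notation hlog := (log_exponent k).
Local Notation phase := (zero_mode_phase k).

Lemma kappaDl X1 X2 Y n : kappa (fieldD X1 X2) Y n = kappa X1 Y n + kappa X2 Y n.
Proof.
rewrite -big_split; apply: eq_bigr => j _ /=; rewrite -mulrDr; congr (_ * _).
by rewrite -big_split; apply: eq_bigr => i _ /=; rewrite mulrDl.
Qed.

Lemma kappaDr X Y1 Y2 n : kappa X (fieldD Y1 Y2) n = kappa X Y1 n + kappa X Y2 n.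
Proof. by rewrite -big_split; apply: eq_bigr => j _ /=; rewrite -mulrDl. Qed.

Lemma kappaNl X Y n : kappa (fieldN X) Y n = - kappa X Y n.
Proof.
rewrite -sumrN; apply: eq_bigr => j _ /=; rewrite -mulrN; congr (_ * _).
by rewrite -sumrN; apply: eq_bigr => i _ /=; rewrite mulNr.
Qed.

Lemma kappaNr X Y n : kappa X (fieldN Y) n = - kappa X Y n.
Proof. by rewrite -sumrN; apply: eq_bigr => j _ /=; rewrite mulNr. Qed.

Lemma hlog_add X Y b : hlog (fieldD X Y) b = hlog X b + hlog Y b.
Proof. by rewrite -big_split; apply: eq_bigr => i _; rewrite /= mulrDl. Qed.

Lemma hlog_opp X b : hlog (fieldN X) b = - hlog X b.
Proof. by rewrite -sumrN; apply: eq_bigr => i _; rewrite /= mulNr. Qed.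

Lemma hlog_bosonN a N s b : hlog (bosonN lq a N s) b = zeromode k a b / N.
Proof.
rewrite mulrC; apply: etrans (sum_pick a (fun=> N^-1) (fun i => zeromode k i b)).
by apply: eq_bigr => i _ /=; case: eqP => _; rewrite ?mul1r ?mul0r.
Qed.

Lemma phase_add X Y b : phase (fieldD X Y) b = phase X b * phase Y b.
Proof.
by rewrite -cexpD -big_split; congr cexp; apply: eq_bigr => i _; rewrite /= mulrDl.
Qed.

Lemma phase_opp X b : phase (fieldN X) b = (phase X b)^-1.
Proof.
have h : phase X b != 0 by exact: cexp_neq0.
apply: (mulfI h); rewrite divff // -cexpD.
rewrite -[RHS]cexp0; congr cexp; rewrite -big_split big1 // => i _ /=.
by rewrite mulNr subrr.
Qed.

Lemma phase_bosonN a N s b :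
  phase (bosonN lq a N s) b = qpow lq (s * zeromode k a b / N).
Proof.
congr cexp; apply: etrans (_ : s * lq / N * zeromode k a b = _); last by ring.
apply: etrans (sum_pick a (fun=> s * lq / N) (fun i => zeromode k i b)).
by apply: eq_bigr => i _ /=; case: eqP => _; rewrite ?mulr1n ?mulr0n; ring.
Qed.

Lemma zeromode_mom i X : zeromode k i (field_mom X) = \sum_(j < 4) fQ X j * cpl k i j.
Proof.
transitivity (\sum_(j < 4) fQ X j * zeromode k i (Qmom R j)).
  rewrite /zeromode /field_mom.
  under eq_bigr => l _ do rewrite summxE mulr_suml.
  rewrite exchange_big /=; apply: eq_bigr => j _; rewrite mulr_sumr.
  by apply: eq_bigr => l _; rewrite mxE mulrA.
apply: eq_bigr => j _; congr (_ * _); rewrite /zeromode /Qmom.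
case: (unliftP ord0 j) => [j' ->|->].
  rewrite (bigD1 j') //= mxE !eqxx mul1r big1 ?addr0 // => l /negbTE h.
  by rewrite mxE h andbF mul0r.
rewrite -(cpl_row0 hk) -sumrN; apply: eq_bigr => l _.
by rewrite !mxE mulN1r.
Qed.

Lemma zeromode_momD i X Y : zeromode k i (field_mom (fieldD X Y)) =
  zeromode k i (field_mom X) + zeromode k i (field_mom Y).
Proof.
by rewrite !zeromode_mom -big_split; apply: eq_bigr => j _; rewrite /= mulrDl.
Qed.

Lemma zeromode_momN i X : zeromode k i (field_mom (fieldN X)) =
  - zeromode k i (field_mom X).
Proof.
by rewrite !zeromode_mom -sumrN; apply: eq_bigr => j _; rewrite /= mulNr.
Qed.

Lemma zeromode_mom_bosonN i a N s :
  zeromode k i (field_mom (bosonN lq a N s)) = cpl k i a / N.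
Proof.
rewrite zeromode_mom mulrC.
apply: etrans (sum_pick a (fun=> N^-1) (fun j => cpl k i j)).
by apply: eq_bigr => j _ /=; case: eqP => _; rewrite ?mul1r ?mul0r.
Qed.

(** q^{xn} *)
Definition qexp (x : K) (n : int) : K := qpow lq (x * n%:~R).
(** (q - q^{-1}) [xn]; the common denominator of the q-numbers cancels in every
    contraction. *)
Definition qbracket (x : K) (n : int) : K := qexp x n - (qexp x n)^-1.

Lemma qexpD x y n : qexp (x + y) n = qexp x n * qexp y n.
Proof. by rewrite /qexp mulrDl qpowD. Qed.
Lemma qexpN x n : qexp (- x) n = (qexp x n)^-1.
Proof. by rewrite /qexp mulNr qpowN. Qed.
Lemma qexp0 n : qexp 0 n = 1. Proof. by rewrite /qexp mul0r qpow0. Qed.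
Lemma qexpx0 x : qexp x 0 = 1. Proof. by rewrite /qexp mulr0 qpow0. Qed.
Lemma qexpDn x m n : qexp x (m + n) = qexp x m * qexp x n.
Proof. by rewrite /qexp rmorphD mulrDr qpowD. Qed.
Lemma qexpNn x n : qexp x (- n) = (qexp x n)^-1.
Proof. by rewrite /qexp rmorphN mulrN qpowN. Qed.
Lemma qexp_neq0 x n : qexp x n != 0. Proof. exact: qpow_neq0. Qed.

Definition qdenom : K := qpow lq 1 - qpow lq (- 1).

Lemma qdenom_neq0 : qdenom != 0.
Proof. by rewrite /qdenom qpowN; exact: (qpow_nat_sub hq (ltn0Sn 0)). Qed.

Lemma qnum_qbracket x n : qnum lq (x * n%:~R) = qbracket x n / qdenom.
Proof. by rewrite /qnum /qbracket /qexp qpowN. Qed.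

Lemma qbracket1_neq0 (n : int) : n != 0 -> qbracket 1 n != 0.
Proof.
have P (m : nat) : (0 < m)%N -> qbracket 1 m%:Z != 0.
  by move=> m0; rewrite /qbracket /qexp mul1r; exact: qpow_nat_sub.
case: n => [n|n] n0; first by apply: P; lia.
rewrite NegzE /qbracket !qexpNn invrK -opprB oppr_eq0; exact: P.
Qed.

Definition regular_level N := N != 0 /\ forall n : int, n != 0 -> qbracket N n != 0.

Lemma regular_level1 : regular_level 1.
Proof. by split; [exact: oner_neq0|exact: qbracket1_neq0]. Qed.

Lemma regular_level_cpl a c N : a != c -> N = cpl k a c + 1 -> regular_level N.
Proof.
move=> ab ->; have [l ->] := cpl_generic k ab; have [h0 h] := hgen l.
have P (m : nat) : (0 < m)%N -> qbracket (k l + 2%:R) m%:Z != 0.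
  move=> m0; have := h m m0; rewrite (qnum_qbracket _ m%:Z) mulf_eq0 negb_or.
  by case/andP.
split=> // -[n|n] n0; first by apply: P; lia.
rewrite NegzE /qbracket !qexpNn invrK -opprB oppr_eq0; exact: P.
Qed.

(** a_i(z) is the field a_i(N;z) of level N = 1, so fermionic and bosonic
    currents have the same building blocks. *)
Lemma boson_bosonN a : boson R a = bosonN lq a 1 0.
Proof.
rewrite /boson /bosonN; congr Field; apply/funext => j.
- by rewrite divr1.
- by rewrite divr1.
- by rewrite mul0r mulr0.
apply/funext => n; case: eqP => // _; rewrite mul1r oppr0 mul0r qpow0 mulr1.
congr (- _); have [->|n0] := eqVneq n 0; first by rewrite mulr0z invr0 mulr0.
rewrite -[n%:~R]mul1r qnum_qbracket divff ?mul1r //.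
by rewrite mulf_neq0 ?invr_neq0 ?qdenom_neq0 ?qbracket1_neq0.
Qed.

Lemma kappa_bosonN a c N M s t n : regular_level N -> regular_level M -> (0 < n)%N ->
  kappa (bosonN lq a N s) (bosonN lq c M t) n =
  - (qbracket 1 n * qbracket (cpl k a c) n / (qbracket N n * qbracket M n)) * qexp (t - s)
    n / n%:R.
Proof.
move=> [N0 hN] [M0 hM] n0; have nz : n%:Z != 0 by lia.
have nK : n%:R != 0 :> K by rewrite pnatr_eq0; lia.
rewrite /kappa sum_pick /= sum_pick /comm_coef.
have eN : (- n%:Z)%:~R = - n%:R :> K by rewrite rmorphN.
have eP : n%:Z%:~R = n%:R :> K by [].
have eQ x : qnum lq (x * n%:R) = qbracket x n / qdenom by exact: (qnum_qbracket x n).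
have eQN x : qnum lq (- x) = - qnum lq x by rewrite /qnum opprK -mulNr opprB.
have e1 : qnum lq n%:R = qbracket 1 n / qdenom by rewrite -eQ mul1r.
have et : qpow lq (- (- t * n%:R)) = qexp t n by rewrite mulNr opprK.
have es : qpow lq (- s * n%:R) = (qexp s n)^-1 by rewrite -qexpN.
rewrite eN eP !mulrN et es /comm_coef !eQN !eQ e1 qexpD qexpN.
have := hN _ nz; have := hM _ nz; have := qbracket1_neq0 nz; have := qdenom_neq0.
have := qexp_neq0 s n;
  move: (qexp s n) (qexp t n) (qbracket 1 n) (qbracket N n) (qbracket M n) qdenom (qbracket _ n).
by move=> A B C D E G H *; field; do ?[apply/andP; split].
Qed.

End Fields.

Section Currents.
Variables (R : realType) (lq : R[i]) (k : 'I_3 -> R[i]).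
Local Notation K := (R[i]).
Implicit Types (X Y : field R) (a c : 'I_4) (b : momentum R) (s t N M e d x y : K).
Hypothesis hq : `|cexp lq| < 1.
Hypothesis hk : \sum_(i < 3) k i = - 4%:R.
Hypothesis hgen : generic lq k.
Local Notation kappa := (osc_pairing lq k).
Local Notation hlog := (log_exponent k).
Local Notation phase := (zero_mode_phase k).
Local Notation qn := (qexp lq).
Local Notation num := (qbracket lq).
Local Notation good_level := (regular_level lq).

(** The common shape of the fields r_i^e, for the pair {a_j, a_l}, and t_i^e,
    for the pair {a_0, a_i}, where N = k_i + 2. *)
Definition pair_field a a' N e : field R :=
  fieldD (fieldN (bosonN lq a N 0)) (fieldN (bosonN lq a' N (- e * N))).

Definition is_sign e := e = 1 \/ e = - 1.

(** [x] + [y] q^{-e(x+y)} = [x+y] q^{-ey}, the relation behind all the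
    contractions: it makes the denominator [Nn] of a pair of level N = x + y
    (or -N) disappear. *)
Lemma qbracket_twist e x y n : is_sign e ->
  num x n + num y n * qn (- e * (x + y)) n = num (x + y) n * qn (- e * y) n.
Proof.
move=> he; have hx := qexp_neq0 lq x n; have hy := qexp_neq0 lq y n.
rewrite /num; case: he => ->; rewrite ?opprK ?mul1r ?mulN1r ?qexpN qexpD;
  move: hx hy; move: (qn x n) (qn y n) => u v hu hv; field; rewrite ?hu ?hv //.
Qed.

Lemma qbracketN x n : num (- x) n = - num x n.
Proof. by rewrite /num qexpN invrK opprB. Qed.

Lemma kappa_sigma_pair c a a' N e n : good_level N -> (0 < n)%N ->
  kappa (bosonN lq c 1 0) (pair_field a a' N e) n =
  (num (cpl k c a) n + num (cpl k c a') n * qn (- e * N) n) / num N n / n%:R.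
Proof.
move=> hN n0; have h1 := regular_level1 hq.
rewrite kappaDr !kappaNr !kappa_bosonN // !subr0 qexp0.
have nz : n%:Z != 0 by lia.
have := proj2 h1 _ nz; have := proj2 hN _ nz.
have : n%:R != 0 :> K by rewrite pnatr_eq0; lia.
move: (num 1 n) (num N n) (qn _ n) (num _ n) (num _ n) => A B C D E *.
by field; do ?[apply/andP; split].
Qed.

Lemma kappa_pair_sigma c a a' N e n : good_level N -> (0 < n)%N ->
  kappa (pair_field a a' N e) (bosonN lq c 1 0) n =
  (num (cpl k a c) n + num (cpl k a' c) n * qn (e * N) n) / num N n / n%:R.
Proof.
move=> hN n0; have h1 := regular_level1 hq.
rewrite kappaDl !kappaNl !kappa_bosonN //.
have -> : 0 - - e * N = e * N by ring.
rewrite subr0 qexp0.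
have nz : n%:Z != 0 by lia.
have := proj2 h1 _ nz; have := proj2 hN _ nz.
have : n%:R != 0 :> K by rewrite pnatr_eq0; lia.
move: (num 1 n) (num N n) (qn _ n) (num _ n) (num _ n) => A B C D E *.
by field; do ?[apply/andP; split].
Qed.

(** The twist identity, applied to the two bosons of the first pair against
    each boson of the second, removes the denominator [Nn]. The difference of
    powers of q that is left vanishes for d = -e and is divisible by [Mn] for d
    = e. *)
Lemma kappa_pair_pair a c c' N M e d n : is_sign e -> good_level N -> good_level M ->
  cpl k a c = N - 1 -> cpl k c c' = M - 1 -> cpl k a c' = 1 - N - M -> (0 < n)%N ->
  kappa (pair_field a c N e) (pair_field c c' M d) n =
  - (num 1 n / num M n) * (qn e n - qn (- d * M - e * (M - 1)) n) / n%:R.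
Proof.
move=> he hN hM hac hcc' hac' n0.
have nz : n%:Z != 0 by lia.
have hN' := proj2 hN _ nz; have hM' := proj2 hM _ nz.
have nK : n%:R != 0 :> K by rewrite pnatr_eq0; lia.
have he' : is_sign (- e) by case: he => ->; [right|left]; rewrite ?opprK.
have t1 := qbracket_twist (N - 1) 1 n he'.
have t2 := qbracket_twist (1 - N - M) (M - 1) n he.
have E2 : 1 - N - M + (M - 1) = - N by ring.
rewrite E2 qbracketN mulrNN in t2; rewrite subrK opprK mulr1 in t1.
rewrite kappaDl !kappaDr !kappaNl !kappaNr !kappa_bosonN // hac hcc' hac' cplii.
have -> : 0 - - e * N = e * N by ring.
have -> : - d * M - - e * N = - d * M + e * N by ring.
rewrite !subr0 qexp0 qexpD.
have -> : - d * M - e * (M - 1) = - d * M + - e * (M - 1) by ring.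
rewrite qexpD.
have {}t1 : num (N - 1) n = num N n * qn e n - num 1 n * qn (e * N) n.
  by rewrite -t1 addrK.
have {}t2 : num (1 - N - M) n =
    - num N n * qn (- e * (M - 1)) n - num (M - 1) n * qn (e * N) n.
  by rewrite -t2 addrK.
rewrite t1 t2; have h1 := proj2 (regular_level1 hq) _ nz.
move: (num 1 n) (num N n) (num M n) (num (M - 1) n) hN' hM' h1 => A B C D *.
move: (qn e n) (qn (e * N) n) (qn (- d * M) n) (qn (- e * (M - 1)) n) => E F G H.
by field; do ?[apply/andP; split].
Qed.

Lemma kappa_pair_pair_rev a c c' N M e d n : is_sign e -> good_level N -> good_level M ->
  cpl k a c = N - 1 -> cpl k c c' = M - 1 -> cpl k a c' = 1 - N - M -> (0 < n)%N ->
  kappa (pair_field c c' M d) (pair_field a c N e) n =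
  - (num 1 n / num M n) * (qn (- e) n - qn (d * M + e * (M - 1)) n) / n%:R.
Proof.
move=> he hN hM hac hcc' hac' n0.
have nz : n%:Z != 0 by lia.
have hN' := proj2 hN _ nz; have hM' := proj2 hM _ nz.
have nK : n%:R != 0 :> K by rewrite pnatr_eq0; lia.
have he' : is_sign (- e) by case: he => ->; [right|left]; rewrite ?opprK.
have t1 := qbracket_twist (N - 1) 1 n he.
have t2 := qbracket_twist (1 - N - M) (M - 1) n he'.
have E2 : 1 - N - M + (M - 1) = - N by ring.
rewrite E2 qbracketN mulrNN opprK in t2; rewrite subrK mulr1 in t1.
rewrite kappaDl !kappaDr !kappaNl !kappaNr !kappa_bosonN //.
rewrite !(cplC k c) !(cplC k c') hac hcc' hac' cplii.
have -> : 0 - - d * M = d * M by ring.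
have -> : - e * N - - d * M = d * M + - e * N by ring.
rewrite !subr0 qexp0 !qexpD.
have {}t1 : num (N - 1) n = num N n * qn (- e) n - num 1 n * qn (- e * N) n.
  by rewrite -t1 addrK.
have {}t2 : num (1 - N - M) n =
    - num N n * qn (e * (M - 1)) n - num (M - 1) n * qn (- e * N) n.
  by rewrite -t2 addrK.
rewrite t1 t2; have h1 := proj2 (regular_level1 hq) _ nz.
move: (num 1 n) (num N n) (num M n) (num (M - 1) n) hN' hM' h1 => A B C D *.
move: (qn (- e) n) (qn (- e * N) n) (qn (d * M) n) (qn (e * (M - 1)) n) => E F G H.
by field; do ?[apply/andP; split].
Qed.

End Currents.

(** * Currents that differ by a shift of the argument *)

Section FieldIdentities.
Variables (R : realType) (lq : R[i]).
Local Notation K := (R[i]).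
Implicit Types (X Y : field R) (a c : 'I_4) (b : momentum R) (s t N M e d x y : K).
Hypothesis hq : `|cexp lq| < 1.
Local Notation qn := (qexp lq).
Local Notation num := (qbracket lq).
Local Notation good_level := (regular_level lq).
Local Notation pairfield := (pair_field lq).
Local Notation shiftf := (shift_field lq).

Lemma sqr_sub1_neq0 x : x != 0 -> x - x^-1 != 0 -> x * x - 1 != 0.
Proof.
move=> x0; apply: contraNN => /eqP h; apply/eqP.
by apply: (mulfI x0); rewrite mulrBr divff // h mulr0.
Qed.

Lemma fosc_bosonN a N s i (n : int) : fosc (bosonN lq a N s) i n =
  if i == a then - (num 1 n / num N n / n%:~R / qn s n) else 0.
Proof.
rewrite /=; case: eqP => // _; congr (- _).
rewrite qnum_qbracket -[X in qnum lq X](mul1r n%:~R) qnum_qbracket.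
have -> : qpow lq (- s * n%:~R) = (qn s n)^-1 by rewrite -qexpN.
congr (_ / _ / _); rewrite invfM invrK mulrACA mulVf ?mulr1 //.
exact: qdenom_neq0 hq.
Qed.

Lemma shift_osc s (n : int) : qpow lq (- s * n%:~R) = (qn s n)^-1.
Proof. by rewrite -qexpN. Qed.

Lemma fosc_pairfield a a' N e i n : fosc (pairfield a a' N e) i n =
  (if i == a then num 1 n / num N n / n%:~R else 0) +
  (if i == a' then num 1 n / num N n / n%:~R / qn (- e * N) n else 0).
Proof.
have -> : fosc (pairfield a a' N e) i n =
   - fosc (bosonN lq a N 0) i n - fosc (bosonN lq a' N (- e * N)) i n by [].
rewrite !fosc_bosonN qexp0 divr1.
by case: eqP; case: eqP => _ _; rewrite ?opprK ?oppr0.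
Qed.

Lemma fosc_shift s X i n : fosc (shiftf s X) i n = fosc X i n / qn s n.
Proof. by rewrite /= shift_osc. Qed.

(** -a_A(w) - a_B(q^{-eN} w) becomes -a_A(q^{eN} w') - a_B(w') for w = q^{eN}
    w'. *)
Lemma pairfield_swap a a' N e :
  pairfield a' a N e = shiftf (- e * N) (pairfield a a' N (- e)).
Proof.
congr Field; apply/funext => i.
- by rewrite /= addrC.
- by rewrite /= addrC.
- by rewrite /=; ring.
apply/funext => n; apply: etrans (fosc_pairfield _ _ _ _ _ _) _.
apply: esym; apply: etrans (fosc_shift _ _ _ _) _.
rewrite fosc_pairfield opprK mulrDl addrC mulNr qexpN invrK.
have h := qexp_neq0 lq (e * N) n.
by congr (_ + _); case: eqP => _; rewrite ?mul0r // mulfVK.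
Qed.

(** Both sides are shifts, by N and -N, of one field that does not depend on
    the sign. *)
Lemma sigma_pair_shift a a' N : a != a' -> N != 0 -> (forall n : int, n != 0 -> num N n != 0) ->
  fieldD (shiftf (- 1 * (1 - N)) (bosonN lq a 1 0)) (pairfield a a' N (- 1)) =
  shiftf (2%:R * N) (fieldD (shiftf (1 * (1 - N)) (bosonN lq a 1 0)) (pairfield a a' N 1)).
Proof.
move=> aa' N0 hN; congr Field; apply/funext => i //.
  rewrite /=; have [->|ia] := eqVneq i a.
    by rewrite (negbTE aa') mulr0n mulr1n; field.
  by rewrite mulr0n; case: eqP => _; rewrite ?mulr0n ?mulr1n; field.
apply/funext => n; apply: esym; apply: etrans (fosc_shift _ _ _ _) _.
have e X Y t : fosc (fieldD (shiftf t X) Y) i n = fosc X i n / qn t n + fosc Y i n.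
  by rewrite -fosc_shift.
rewrite [X in X / _]e [RHS]e !fosc_pairfield !fosc_bosonN.
have [->|n0] := eqVneq n 0.
  by rewrite mulr0z invr0 !(mulr0, mul0r, if_same, oppr0, addr0).
have nK : n%:~R != 0 :> K by rewrite intr_eq0.
have h1 := proj2 (regular_level1 hq) _ n0; have h2 := hN _ n0.
have ha := qexp_neq0 lq 1 n; have hb := qexp_neq0 lq N n.
rewrite !mulN1r !mul1r opprK mulr2n !mulrDl !mul1r !(qexpN, qexpD, qexp0) /qbracket.
have [->|ia] := eqVneq i a.
  rewrite (negbTE aa'); move: h1 h2; rewrite /qbracket.
  move: (n%:~R : K) nK (qn 1 n) (qn N n) ha hb => n' nK A B hA hB h1 h2.
  by field; rewrite nK hA hB ?sqr_sub1_neq0.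
case: eqP => _; last by rewrite !(mul0r, addr0).
move: h1 h2; rewrite /qbracket.
move: (n%:~R : K) nK (qn 1 n) (qn N n) ha hb => n' nK A B hA hB h1 h2.
by field; rewrite ?nK ?hA ?hB ?sqr_sub1_neq0.
Qed.

(** Both sides are shifts, by M and -M, of one field that does not depend on
    the sign: the two poles, at z = q^{-eM} w, are placed symmetrically. *)
Lemma pair_pair_shift a c c' N M : a != c -> a != c' -> c != c' -> N != 0 -> M != 0 ->
  (forall n : int, n != 0 -> num N n != 0) -> (forall n : int, n != 0 -> num M n != 0) ->
  fieldD (shiftf (- - 1 * M) (pairfield a c N (- 1))) (pairfield c c' M (- 1)) =
  shiftf (2%:R * M) (fieldD (shiftf (- 1 * M) (pairfield a c N 1)) (pairfield c c' M 1)).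
Proof.
move=> ac ac' cc' N0 M0 hN hM; congr Field; apply/funext => i //.
  rewrite /=; have [->|ia] := eqVneq i a.
    by rewrite (negbTE ac) (negbTE ac') ?mulr0n ?mulr1n; field; rewrite ?N0 ?M0.
  have [->|ic] := eqVneq i c.
    by rewrite (negbTE cc') ?mulr0n ?mulr1n; field; rewrite ?N0 ?M0.
  by case: eqP => _; rewrite ?mulr0n ?mulr1n; field; rewrite ?N0 ?M0.
apply/funext => n; apply: esym; apply: etrans (fosc_shift _ _ _ _) _.
have e X Y t : fosc (fieldD (shiftf t X) Y) i n = fosc X i n / qn t n + fosc Y i n.
  by rewrite -fosc_shift.
rewrite [X in X / _]e [RHS]e !fosc_pairfield.
have [->|n0] := eqVneq n 0.
  by rewrite mulr0z invr0 !(mulr0, mul0r, if_same, oppr0, addr0).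
have nK : n%:~R != 0 :> K by rewrite intr_eq0.
have h1 := hM _ n0; have h2 := hN _ n0.
have ha := qexp_neq0 lq M n; have hb := qexp_neq0 lq N n.
rewrite !mulN1r !opprK !mul1r mulr2n !mulrDl !mul1r !(qexpN, qexpD, qexp0).
move: h1 h2; rewrite /qbracket.
move: (n%:~R : K) nK (qn M n) (qn N n) ha hb => n' nK A B hA hB h1 h2.
have [->|ia] := eqVneq i a.
  rewrite (negbTE ac) (negbTE ac').
  by field; rewrite ?nK ?hA ?hB ?sqr_sub1_neq0 ?qexp_neq0.
have [->|ic] := eqVneq i c.
  rewrite (negbTE cc').
  by field; rewrite ?nK ?hA ?hB ?sqr_sub1_neq0 ?qexp_neq0.
case: eqP => _; last by rewrite !(mul0r, addr0).
by field; rewrite ?nK ?hA ?hB ?sqr_sub1_neq0 ?qexp_neq0.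
Qed.

End FieldIdentities.

(** * Exchange relations of the screening currents *)

Section Screening.
Variables (R : realType) (lq : R[i]) (k : 'I_3 -> R[i]).
Local Notation K := (R[i]).
Implicit Types (X Y : field R) (a c : 'I_4) (b : momentum R) (s t N M e d x y : K).
Hypothesis hq : `|cexp lq| < 1.
Hypothesis hk : \sum_(i < 3) k i = - 4%:R.
Hypothesis hgen : generic lq k.
Local Notation kappa := (osc_pairing lq k).
Local Notation hlog := (log_exponent k).
Local Notation phase := (zero_mode_phase k).
Local Notation qn := (qexp lq).
Local Notation num := (qbracket lq).
Local Notation good_level := (regular_level lq).
Local Notation pairfield := (pair_field lq).
Local Notation shiftf := (shift_field lq).
Local Notation sig a := (bosonN lq a 1 0).
Local Notation normexp := (normexp lq k).

(** The condition that selects the sectors on which a bosonic screening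
    operator is defined. *)
Definition integral_charge a a' N b :=
  exists m : int, zeromode k a b + zeromode k a' b = N * m%:~R.

Lemma hlog_pair a a' N e b :
  hlog (pairfield a a' N e) b = - ((zeromode k a b + zeromode k a' b) / N).
Proof. by rewrite hlog_add !hlog_opp !hlog_bosonN; ring. Qed.

Lemma hlog_pair_int a a' N e b : N != 0 -> integral_charge a a' N b ->
  exists m : int, hlog (pairfield a a' N e) b = m%:~R.
Proof.
move=> N0 [m hm]; exists (- m).
by rewrite hlog_pair hm mulrAC divff // mul1r rmorphN.
Qed.

Lemma phase_pair a a' N e b : N != 0 ->
  phase (pairfield a a' N e) b = qpow lq (e * zeromode k a' b).
Proof.
move=> N0; rewrite phase_add !phase_opp !phase_bosonN !mul0r qpow0 invr1 mul1r -qpowN.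
by congr qpow; field.
Qed.

Lemma phase_sigma a b : phase (sig a) b = 1.
Proof. by rewrite phase_bosonN !mul0r qpow0. Qed.

Lemma hlog_sigma a b : hlog (sig a) b = zeromode k a b.
Proof. by rewrite hlog_bosonN divr1. Qed.

Lemma zeromode_mom_pair i a a' N e : zeromode k i (field_mom (pairfield a a' N e)) =
  - ((cpl k i a + cpl k i a') / N).
Proof. by rewrite zeromode_momD // !zeromode_momN // !zeromode_mom_bosonN //; ring. Qed.

Lemma zeromode_mom_sigma i a : zeromode k i (field_mom (sig a)) = cpl k i a.
Proof. by rewrite zeromode_mom_bosonN // divr1. Qed.

Lemma normexp_is_linear X b s (S : int) : s - hlog X b = S%:~R -> linear (normexp X b s).
Proof.
move=> hS t u v.
have [W1 h1] := annihilation_part_nilp lq k X u; have [W2 h2] := annihilation_part_nilp lq k X v.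
have [W3 h3] := annihilation_part_nilp lq k X (t *: u + v).
pose W := (W1 + W2 + W3)%N.
have e1 : normexp X b s u =
  phase X b *: vertex_coef (creation_part X) (annihilation_part lq k X) S W u.
  by apply: normexpE hS _ => x h; apply: h1; lia.
have e2 : normexp X b s v =
  phase X b *: vertex_coef (creation_part X) (annihilation_part lq k X) S W v.
  by apply: normexpE hS _ => x h; apply: h2; lia.
apply: etrans (normexpE hS (W := W) _) _; first by move=> x h; apply: h3; lia.
apply: etrans (esym (congr2 (fun u v => t *: u + v) e1 e2)).
have -> : vertex_coef (creation_part X) (annihilation_part lq k X) S W (t *: u + v) =
   t *: vertex_coef (creation_part X) (annihilation_part lq k X) S W u +
     vertex_coef (creation_part X) (annihilation_part lq k X) S W v.
  rewrite /vertex_coef scaler_sumr -big_split; apply: eq_bigr => x _.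
  have [L ->] := linear_pack (@annihilation_part_is_linear _ lq k X x%:Z).
  by rewrite linearP mulrDr; apply: (congr1 (+%R^~ _)); rewrite scalerAr.
by rewrite scalerDr; apply: (congr1 (+%R^~ _)); apply: scale2; exact: mulrC.
Qed.

Lemma normexp0 X b s : normexp X b s 0 = 0.
Proof.
rewrite /Defs.normexp fsbig1 ?scaler0 // => -[d1 d2] _ /=.
apply: etrans (exp_coef_cre _ _ _ _ _) _.
rewrite exp_coef_ann.
have [L ->] := linear_pack (@annihilation_part_is_linear _ lq k X d1%:Z).
by rewrite linear0 mulr0.
Qed.

Section Level.
Variables (a a' : 'I_4) (N : K).
Hypothesis aa' : a != a'.
Hypothesis hN : N = cpl k a a' + 1.

Let goodN : good_level N := regular_level_cpl hq hgen aa' hN.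
Let N0 : N != 0 := proj1 goodN.

Lemma mulNfK (u v w : K) : u != 0 -> - u * v / u / w = - v / w.
Proof. by move=> u0; rewrite mulNr [u * v]mulrC [_ / u]mulNr mulfK. Qed.

Lemma mulfVK_left (u v w : K) : u != 0 -> u * v / u / w = v / w.
Proof. by move=> u0; rewrite [u * v]mulrC mulfK. Qed.

(** A boson outside the pair: the contraction is z - q^{ex} w up to sign in
    both orders, so the currents anticommute before integration. *)
Lemma sigma_pair_regular c e b p : is_sign e -> c != a -> c != a' ->
  (exists m : int, zeromode k c b = m%:~R) -> integral_charge a a' N b ->
  normexp (sig c) (b + field_mom (pairfield a a' N e)) (- 1)
    (normexp (pairfield a a' N e) b 0 p) +
  normexp (pairfield a a' N e) (b + field_mom (sig c)) 0 (normexp (sig c) b (- 1) p) = 0.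
Proof.
move=> he ca ca' [m hm] /(hlog_pair_int e N0)[m' hm'].
set x := cpl k c a'.
have cax : cpl k c a = - N - x.
  have := cpl_triple hk ca ca' aa'; rewrite -/x => h.
  by rewrite hN -[cpl k c a](addrK (x + cpl k a a')) addrA h; ring.
have hg : hlog (sig c) (field_mom (pairfield a a' N e)) = 1.
  by rewrite hlog_sigma zeromode_mom_pair cax -/x; field.
have hg' : hlog (pairfield a a' N e) (field_mom (sig c)) = 1.
  rewrite hlog_pair !zeromode_mom_sigma (cplC k a) (cplC k a') cax -/x.
  by field.
have he' : is_sign (- e) by case: he => ->; [right|left]; rewrite ?opprK.
have tw f n : is_sign f ->
    num (- N - x) n + num x n * qn (f * N) n = - num N n * qn (- f * x) n.
  move=> hf; have := qbracket_twist lq (- N - x) x n hf.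
  by rewrite subrK qbracketN mulrNN.
have gN n : (0 < n)%N -> num N n%:Z != 0 by move=> n0; apply: (proj2 goodN); lia.
have k1 n : (0 < n)%N ->
    kappa (sig c) (pairfield a a' N e) n = - qn (e * x) n%:Z / n%:R.
  by move=> n0; rewrite kappa_sigma_pair // cax -/x tw // opprK mulNfK // gN.
have k2 n : (0 < n)%N ->
    kappa (pairfield a a' N e) (sig c) n = - qn (- e * x) n%:Z / n%:R.
  move=> n0; rewrite kappa_pair_sigma // (cplC k a) (cplC k a') cax -/x tw //.
  by rewrite mulNfK // gN.
have z0 y : qn y 0 = 1 by exact: qexpx0.
have c1 := scalar_exp_lin (qexpDn lq (e * x)) k1.
have c2 := scalar_exp_lin (qexpDn lq (- e * x)) k2.
have := @normexp_exchange R lq k (sig c) (pairfield a a' N e) b (- 1) 0 0 0 1 1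
  (- 2 - m) (- m') _ _ p _ _ _ _ c1 c2.
rewrite mul0r scale0r scale1r; apply.
- by rewrite hlog_sigma hm !intrD !rmorphN /=; ring.
- by rewrite hm' sub0r rmorphN.
- by rewrite hg.
- by rewrite hg'.
have qe : qn (- e * x) 1 = (qn (e * x) 1)^-1 by rewrite mulNr qexpN.
move=> i; rewrite phase_sigma (phase_pair _ _ _ _ N0) zeromode_mom_sigma mul0r mul1r mul1r.
rewrite (cplC k a') -/x.
have -> : qpow lq (e * x) = qn (e * x) 1 by rewrite /qexp mulr1.
rewrite qe; have qz := qexp_neq0 lq (e * x) 1.
have [->|i0] := eqVneq i 0.
  by rewrite subr0 /= ?mulr1 ?mulrN ?divff // ?subrr //.
have [->|i1] := eqVneq i 1; first by rewrite subrr eqxx mulr1 addNr.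
by rewrite !ifF ?mulr0 ?addr0 //; apply/negbTE; lia.
Qed.

(** A boson of the pair: the contraction is 1/(z - q^{e(1-N)} w), and the
    anticommutator of the currents is a delta function. *)
Lemma sigma_pair_pole e b p : is_sign e ->
  (exists m : int, zeromode k a b = m%:~R) -> integral_charge a a' N b ->
  normexp (sig a) (b + field_mom (pairfield a a' N e)) (- 1)
    (normexp (pairfield a a' N e) b 0 p) +
  normexp (pairfield a a' N e) (b + field_mom (sig a)) 0 (normexp (sig a) b (- 1) p) =
  normexp (fieldD (shiftf (e * (1 - N)) (sig a)) (pairfield a a' N e)) b 0 p.
Proof.
move=> he [m hm] /(hlog_pair_int e N0)[m' hm'].
have ca : cpl k a a' = N - 1 by rewrite hN addrK.
have hg : hlog (sig a) (field_mom (pairfield a a' N e)) = - 1.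
  by rewrite hlog_sigma zeromode_mom_pair ca cplii addrC subrK divff.
have hg' : hlog (pairfield a a' N e) (field_mom (sig a)) = - 1.
  by rewrite hlog_pair !zeromode_mom_sigma (cplC k a') ca cplii addrC subrK divff.
have he' : is_sign (- e) by case: he => ->; [right|left]; rewrite ?opprK.
have tw f n : is_sign f ->
    num 1 n + num (N - 1) n * qn (f * N) n = num N n * qn (f * (N - 1)) n.
  move=> hf; have hf' : is_sign (- f) by case: hf => ->; [right|left]; rewrite ?opprK.
  have E : 1 + (N - 1) = N by rewrite addrC subrK.
  by have := qbracket_twist lq 1 (N - 1) n hf'; rewrite E opprK.
have gN n : (0 < n)%N -> num N n%:Z != 0 by move=> n0; apply: (proj2 goodN); lia.
have k1 n : (0 < n)%N ->
    kappa (sig a) (pairfield a a' N e) n = qn (e * (1 - N)) n%:Z / n%:R.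
  move=> n0; rewrite kappa_sigma_pair // ca cplii tw // mulfVK_left ?gN //.
  by congr (qexp _ _ _ / _); ring.
have k2 n : (0 < n)%N ->
    kappa (pairfield a a' N e) (sig a) n = qn (- e * (1 - N)) n%:Z / n%:R.
  move=> n0; rewrite kappa_pair_sigma // (cplC k a') ca cplii tw // mulfVK_left ?gN //.
  by congr (qexp _ _ _ / _); ring.
have z0 y : qn y 0 = 1 by exact: qexpx0.
have c1 := scalar_exp_geom (z0 _) (qexpDn lq (e * (1 - N))) k1.
have c2 := scalar_exp_geom (z0 _) (qexpDn lq (- e * (1 - N))) k2.
rewrite -[X in _ + X]scale1r.
apply: etrans (@normexp_exchange R lq k (sig a) (pairfield a a' N e) b (- 1) 0 (e * (1 - N)) 1 1
  (- 1) (- m) (- m') _ _ p _ _ _ _ c1 c2 _) _.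
- by rewrite hlog_sigma hm intrD !rmorphN /=; ring.
- by rewrite hm' sub0r rmorphN.
- by rewrite hg rmorphN.
- by rewrite hg' rmorphN.
2: have -> : -1 + 0 - (-1)%:~R = 0 :> K by rewrite rmorphN addr0 subrr.
2: have -> : 1 * qpow lq (e * (1 - N) * ((-1)%:~R - - 1)) = 1 :> K
     by rewrite rmorphN subrr mulr0 qpow0 mulr1.
2: exact: scale1r.
move=> i; rewrite phase_sigma (phase_pair _ _ _ _ N0) zeromode_mom_sigma !mul1r.
rewrite (cplC k a') ca -/(qn _ _).
have -> : qpow lq (e * (N - 1)) = qn (- e * (1 - N)) 1.
  by rewrite /qexp mulr1; congr qpow; ring.
have [i0|i0] := leP 0 i.
  by rewrite ifF ?mulr0 ?addr0 //; apply/negbTE; lia.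
rewrite ifT; last lia.
rewrite add0r -qexpDn mulNr qexpN -qexpNn; congr (qexp _ _ _); lia.
Qed.

End Level.

Section TwoLevels.
Variables (a c c' : 'I_4) (N M : K).
Hypothesis ac : a != c.
Hypothesis ac' : a != c'.
Hypothesis cc' : c != c'.
Hypothesis hN : N = cpl k a c + 1.
Hypothesis hM : M = cpl k c c' + 1.

Let goodN : good_level N := regular_level_cpl hq hgen ac hN.
Let goodM : good_level M := regular_level_cpl hq hgen cc' hM.
Let N0 : N != 0 := proj1 goodN.
Let M0 : M != 0 := proj1 goodM.
Let cac : cpl k a c = N - 1. Proof. by rewrite hN addrK. Qed.
Let ccc' : cpl k c c' = M - 1. Proof. by rewrite hM addrK. Qed.
Let cac' : cpl k a c' = 1 - N - M.
Proof.
have h := cpl_triple hk ac ac' cc'.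
by rewrite hN hM -[LHS](addrK (cpl k a c + cpl k c c')) addrCA addrA h; ring.
Qed.

Let zcY d : zeromode k c (field_mom (pairfield c c' M d)) = - 1.
Proof. by rewrite zeromode_mom_pair ccc' cplii addrC subrK divff. Qed.

Let zaY d : zeromode k a (field_mom (pairfield c c' M d)) = 1.
Proof. by rewrite zeromode_mom_pair cac cac'; field. Qed.

Let zcX e : zeromode k c (field_mom (pairfield a c N e)) = - 1.
Proof. by rewrite zeromode_mom_pair (cplC k c) cac cplii subrK divff. Qed.

Let zc'X e : zeromode k c' (field_mom (pairfield a c N e)) = 1.
Proof. by rewrite zeromode_mom_pair !(cplC k c') cac' ccc'; field. Qed.

Let hXY e d : hlog (pairfield a c N e) (field_mom (pairfield c c' M d)) = 0.
Proof. by rewrite hlog_pair zcY zaY subrr mul0r oppr0. Qed.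

Let hYX e d : hlog (pairfield c c' M d) (field_mom (pairfield a c N e)) = 0.
Proof. by rewrite hlog_pair zcX zc'X addNr mul0r oppr0. Qed.

Let gM n : (0 < n)%N -> num M n%:Z != 0.
Proof. by move=> n0; apply: (proj2 goodM); lia. Qed.

(** Opposite signs contract trivially. *)
Lemma pair_pair_regular e b p : is_sign e ->
  integral_charge a c N b -> integral_charge c c' M b ->
  normexp (pairfield a c N e) (b + field_mom (pairfield c c' M (- e))) 0
    (normexp (pairfield c c' M (- e)) b 0 p) -
  normexp (pairfield c c' M (- e)) (b + field_mom (pairfield a c N e)) 0
    (normexp (pairfield a c N e) b 0 p) = 0.
Proof.
move=> he /(hlog_pair_int e N0)[m hm] /(hlog_pair_int (- e) M0)[m' hm'].
have k1 n : (0 < n)%N -> kappa (pairfield a c N e) (pairfield c c' M (- e)) n = 0.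
  move=> n0; rewrite kappa_pair_pair //.
  have -> : - - e * M - e * (M - 1) = e by ring.
  by rewrite subrr mulr0 mul0r.
have k2 n : (0 < n)%N -> kappa (pairfield c c' M (- e)) (pairfield a c N e) n = 0.
  move=> n0; rewrite kappa_pair_pair_rev //.
  have -> : - e * M + e * (M - 1) = - e by ring.
  by rewrite subrr mulr0 mul0r.
have := @normexp_exchange R lq k (pairfield a c N e) (pairfield c c' M (- e)) b 0 0 0 0 (- 1) 0
  (- m) (- m') _ _ p _ _ _ _ (scalar_exp_zero k1) (scalar_exp_zero k2).
rewrite mul0r scale0r scaleN1r; apply.
- by rewrite hm sub0r addr0 rmorphN.
- by rewrite hm' sub0r rmorphN.
- by rewrite hXY.
- by rewrite hYX.
move=> i; rewrite !phase_pair // zcY zc'X sub0r oppr_eq0 mul0r mulN1r mulr1 mulrN1.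
by rewrite mulNr subrr.
Qed.

Let mobius_coef e n : is_sign e -> num M n != 0 ->
  num 1 n / num M n * (qn e n - qn (- e * M - e * (M - 1)) n) =
  qn (- e * M) n * qn (2%:R * e) n - qn (- e * M) n.
Proof.
move=> he hM'; have qu := qexp_neq0 lq 1 n; have qv := qexp_neq0 lq M n.
move: hM'; rewrite /qbracket => hM'; have hM2 := sqr_sub1_neq0 qv hM'.
case: he => ->.
  have -> : - (1) * M - 1 * (M - 1) = 1 - M - M by ring.
  have -> : 2%:R * 1 = 1 + 1 :> K by ring.
  rewrite mulN1r !qexpD !qexpN; move: (qn 1 n) (qn M n) qu qv hM' hM2 => u v qu qv hM' hM2.
  by field; rewrite ?qu ?qv ?hM2.
have -> : - (-1) * M - (-1) * (M - 1) = M + M - 1 by ring.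
have -> : 2%:R * (-1) = - 1 - 1 :> K by ring.
rewrite opprK mul1r !(qexpD, qexpN); move: (qn 1 n) (qn M n) qu qv hM' hM2 => u v qu qv hM' hM2.
by field; rewrite ?qu ?qv ?hM2.
Qed.

(** Equal signs contract to q^{-e} (1 - q^{2e} t)/(1 - t) with t = q^{-eM} w/z,
    whose residue q^{-e} - q^e is odd in e. *)
Lemma pair_pair_pole e b p : is_sign e ->
  integral_charge a c N b -> integral_charge c c' M b ->
  normexp (pairfield a c N e) (b + field_mom (pairfield c c' M e)) 0
    (normexp (pairfield c c' M e) b 0 p) -
  normexp (pairfield c c' M e) (b + field_mom (pairfield a c N e)) 0
    (normexp (pairfield a c N e) b 0 p) =
  (qpow lq (- e) - qpow lq e) *:
    normexp (fieldD (shiftf (- e * M) (pairfield a c N e)) (pairfield c c' M e)) b 0 p.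
Proof.
move=> he /(hlog_pair_int e N0)[m hm] /(hlog_pair_int e M0)[m' hm'].
have he' : is_sign (- e) by case: he => ->; [right|left]; rewrite ?opprK.
have k1 n : (0 < n)%N -> kappa (pairfield a c N e) (pairfield c c' M e) n =
    - (qn (- e * M) n%:Z * qn (2%:R * e) n%:Z - qn (- e * M) n%:Z) / n%:R.
  by move=> n0; rewrite kappa_pair_pair // -mobius_coef ?gM // mulNr.
have k2 n : (0 < n)%N -> kappa (pairfield c c' M e) (pairfield a c N e) n =
    - (qn (- - e * M) n%:Z * qn (2%:R * - e) n%:Z - qn (- - e * M) n%:Z) / n%:R.
  move=> n0; rewrite kappa_pair_pair_rev //.
  have -> : e * M + e * (M - 1) = - - e * M - - e * (M - 1) by ring.
  by rewrite -mobius_coef ?gM // mulNr.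
have z0 y : qn y 0 = 1 by exact: qexpx0.
have c1 := scalar_exp_mobius (qexpDn lq (- e * M)) (qexpDn lq (2%:R * e)) k1.
have c2 := scalar_exp_mobius (qexpDn lq (- - e * M)) (qexpDn lq (2%:R * - e)) k2.
rewrite -[X in _ + X]scaleN1r.
apply: etrans (@normexp_exchange R lq k (pairfield a c N e) (pairfield c c' M e) b 0 0 (- e * M)
  (qpow lq (- e) - qpow lq e) (- 1) 0 (- m) (- m') _ _ p _ _ _ _ c1 c2 _) _.
- by rewrite hm sub0r addr0 rmorphN.
- by rewrite hm' sub0r rmorphN.
- by rewrite hXY.
- by rewrite hYX.
2: have -> : 0 + 0 - 0%:~R = 0 :> K by rewrite subr0 addr0.
2: have -> : (qpow lq (- e) - qpow lq e) * qpow lq (- e * M * (0%:~R - 0)) =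
     qpow lq (- e) - qpow lq e by rewrite subrr mulr0 qpow0 mulr1.
2: by [].
move=> i; rewrite !phase_pair // zcY zc'X sub0r oppr_eq0 mulN1r mulr1 mulrN1.
have -> : qpow lq (- e * M * i%:~R) = qn (- e * M) i by [].
have q1 : qn (2%:R * e) 1 = qpow lq e * qpow lq e.
  by rewrite /qexp mulr1 -qpowD; congr qpow; ring.
have q2 : qn (2%:R * - e) 1 = (qpow lq e)^-1 * (qpow lq e)^-1.
  by rewrite /qexp mulr1 -qpowN -qpowD; congr qpow; ring.
have h := qpow_neq0 lq e.
rewrite q1 q2 qpowN; have [->|i0] := eqVneq i 0; first by rewrite z0; ring.
have [ip|ip] := leP 0 i.
  by rewrite ifF; [field|apply/negbTE; lia].
rewrite ifT; last lia.
have -> : qn (- - e * M) (- i) = qn (- e * M) i.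
  by rewrite qexpNn -qexpN -mulNr opprK.
by field.
Qed.

End TwoLevels.

End Screening.

(** * Screening operators on a sector *)

Section LinearScale.
Variables (K : numFieldType) (V : lmodType K).

Lemma linear_scaleB (f : V -> V) (r : K) (u v : V) : linear f ->
  f (r *: (u - v)) = r *: (f u - f v).
Proof. by move=> /linear_pack[L ->]; rewrite linearZ linearB. Qed.

Lemma scaleB_opp (r : K) (u v : V) : - (r *: (u - v)) = r *: (v - u).
Proof. by rewrite -scalerN opprB. Qed.

Lemma linear_opp_add (f : V -> V) (u v : V) : linear f -> f (- u) + - v = - (f u + v).
Proof. by move=> /linear_pack[L ->]; rewrite linearN opprD. Qed.

Lemma scaleB_add (r : K) (u v u' v' z : V) : u + u' = z -> v + v' = z ->
  r *: (u - v) + r *: (u' - v') = 0.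
Proof. by move=> h h'; rewrite -scalerDr addrACA -opprD h h' subrr scaler0. Qed.

(** The shape of the commutator of two bosonic screening operators: the mixed
    terms pm and mp commute, and the commutators of the terms with equal signs
    cancel. *)
Lemma scaleB_sub (r s : K) (pp pm mp mm pp' pm' mp' mm' z : V) :
  pp - pp' = s *: z -> mm - mm' = - s *: z -> pm - pm' = 0 -> mp - mp' = 0 ->
  r *: (r *: (pp - pm) - r *: (mp - mm)) = r *: (r *: (pp' - mp') - r *: (pm' - mm')).
Proof.
move=> h1 h2 /subr0_eq -> /subr0_eq ->; rewrite -!scalerBr; congr (_ *: (_ *: _)).
rewrite !opprB ![_ - _ + (_ - _)]addrACA -!opprD [mp' + pm']addrC; congr (_ - _).
have -> : pp = s *: z + pp' by rewrite -h1 subrK.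
have -> : mm = - s *: z + mm' by rewrite -h2 subrK.
by rewrite addrACA scaleNr subrr add0r.
Qed.

End LinearScale.

Section Operators.
Variables (R : realType) (lq : R[i]) (k : 'I_3 -> R[i]).
Local Notation K := (R[i]).
Implicit Types (X Y : field R) (a c : 'I_4) (b : momentum R) (s t N M e d x y : K).
Hypothesis hq : `|cexp lq| < 1.
Hypothesis hk : \sum_(i < 3) k i = - 4%:R.
Hypothesis hgen : generic lq k.
Local Notation pairfield := (pair_field lq).
Local Notation shiftf := (shift_field lq).
Local Notation sig a := (bosonN lq a 1 0).
Local Notation normexp := (normexp lq k).
Local Notation integral_pair := (integral_charge k).
Local Notation hlog := (log_exponent k).

(** The bosonic screening operator of a pair of bosons of level N. *)
Definition screening a a' N b (p : Fock R) : Fock R :=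
  qdiff lq k (pairfield a a' N 1) (pairfield a a' N (- 1)) b (- 1) p.

Lemma screeningE a a' N b p : screening a a' N b p = (qdenom lq)^-1 *:
  (normexp (pairfield a a' N 1) b 0 p - normexp (pairfield a a' N (- 1)) b 0 p).
Proof. by rewrite /screening /qdiff addNr. Qed.

Lemma hlogD_int X Y b : (exists m : int, hlog X b = m%:~R) ->
  (exists m : int, hlog Y b = m%:~R) ->
  exists m : int, hlog (fieldD X Y) b = m%:~R.
Proof. by move=> [m hm] [n hn]; exists (m + n); rewrite hlog_add hm hn intrD. Qed.

Lemma normexp_shift0 s X b p : (exists m : int, hlog X b = m%:~R) ->
  normexp (shiftf s X) b 0 p = normexp X b 0 p.
Proof.
move=> [m hm]; rewrite (@normexp_shift _ _ _ _ _ _ _ (- m)).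
  by rewrite mulr0 qpow0 scale1r.
by rewrite hm sub0r rmorphN.
Qed.

Lemma normexp_pair_linear a a' N e b : N != 0 -> integral_pair a a' N b ->
  linear (normexp (pairfield a a' N e) b 0).
Proof.
move=> N0 /(hlog_pair_int lq e N0)[m hm].
have h : 0 - hlog (pairfield a a' N e) b = (- m)%:~R by rewrite hm sub0r rmorphN.
exact: normexp_is_linear h.
Qed.

Lemma normexp_sigma_linear a b : (exists m : int, zeromode k a b = m%:~R) ->
  linear (normexp (sig a) b (- 1)).
Proof.
move=> [m hm].
have h : - 1 - hlog (sig a) b = (- 1 - m)%:~R by rewrite hlog_sigma hm intrB rmorphN.
exact: normexp_is_linear h.
Qed.

(** The shift of the argument in [pairfield_swap] is invisible in the
    coefficient of z^0, and the sign e changes. *)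
Lemma screening_swap a a' N b p : N != 0 -> integral_pair a a' N b ->
  screening a' a N b p = - screening a a' N b p.
Proof.
move=> N0 hb.
have h e : normexp (pairfield a' a N e) b 0 p = normexp (pairfield a a' N (- e)) b 0 p.
  rewrite (pairfield_swap hq); apply: normexp_shift0; exact: hlog_pair_int.
have h1 := h 1; have := h (- 1); rewrite opprK => h2.
apply: etrans (screeningE a' a N b p) _.
apply: etrans (congr2 (fun u v => _ *: (u - v)) h1 h2) _.
apply: esym; apply: etrans (congr1 -%R (screeningE a a' N b p)) _.
exact: scaleB_opp.
Qed.

Lemma integral_pairC a a' N b : integral_pair a a' N b -> integral_pair a' a N b.
Proof. by move=> [m hm]; exists m; rewrite addrC. Qed.

Lemma mom_swap a a' N e : field_mom (pairfield a' a N e) = field_mom (pairfield a a' N e).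
Proof. by rewrite (pairfield_swap hq). Qed.

Lemma mom_sign a a' N e : field_mom (pairfield a a' N 1) = field_mom (pairfield a a' N e).
Proof. by apply: eq_bigr => i _. Qed.

Section SigmaPair.
Variables (a a' : 'I_4) (N : K).
Hypothesis aa' : a != a'.
Hypothesis hN : N = cpl k a a' + 1.

Let goodN : regular_level lq N := regular_level_cpl hq hgen aa' hN.
Let N0 : N != 0 := proj1 goodN.

(** The two signs contribute the same element z, with opposite signs. *)
Lemma sigma_screening_of_currents c b p z : 
  (exists m : int, zeromode k c (b + field_mom (pairfield a a' N 1)) = m%:~R) ->
  (forall e, is_sign e ->
     normexp (sig c) (b + field_mom (pairfield a a' N e)) (- 1)
       (normexp (pairfield a a' N e) b 0 p) +
     normexp (pairfield a a' N e) (b + field_mom (sig c)) 0 (normexp (sig c) b (- 1) p)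
     = z) ->
  normexp (sig c) (b + field_mom (pairfield a a' N 1)) (- 1) (screening a a' N b p) +
  screening a a' N (b + field_mom (sig c)) (normexp (sig c) b (- 1) p) = 0.
Proof.
move=> hc h; have lin := linear_scaleB _ _ _ (normexp_sigma_linear hc).
apply: etrans (congr2 +%R (etrans (congr1 _ (screeningE a a' N b p)) (lin _ _ _))
  (screeningE _ _ _ _ _)) _.
apply: (@scaleB_add _ _ _ _ _ _ _ z); first exact: (h 1 (or_introl erefl)).
by rewrite (mom_sign _ _ _ (- 1)); exact: (h (- 1) (or_intror erefl)).
Qed.

Lemma sigma_screening_regular c b p : c != a -> c != a' ->
  (exists m : int, zeromode k c b = m%:~R) ->
  (exists m : int, zeromode k c (b + field_mom (pairfield a a' N 1)) = m%:~R) ->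
  integral_pair a a' N b ->
  normexp (sig c) (b + field_mom (pairfield a a' N 1)) (- 1) (screening a a' N b p) +
  screening a a' N (b + field_mom (sig c)) (normexp (sig c) b (- 1) p) = 0.
Proof.
move=> ca ca' hc hc' hb; apply: (sigma_screening_of_currents (z := 0)) => // e he.
exact: sigma_pair_regular.
Qed.

(** Both signs give the coefficient of z^0 of the same exponential, up to a
    shift. *)
Lemma sigma_screening_pole b p :
  (exists m : int, zeromode k a b = m%:~R) ->
  (exists m : int, zeromode k a (b + field_mom (pairfield a a' N 1)) = m%:~R) ->
  integral_pair a a' N b ->
  normexp (sig a) (b + field_mom (pairfield a a' N 1)) (- 1) (screening a a' N b p) +
  screening a a' N (b + field_mom (sig a)) (normexp (sig a) b (- 1) p) = 0.
Proof.
move=> ha ha' hb.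
apply: (sigma_screening_of_currents
  (z := normexp (fieldD (shiftf (1 * (1 - N)) (sig a)) (pairfield a a' N 1)) b 0 p)) => //.
move=> e he; rewrite (sigma_pair_pole hq hk hgen aa' hN p he ha hb).
case: he => ->; first by [].
rewrite (sigma_pair_shift hq aa' N0 (proj2 goodN)); apply: normexp_shift0.
apply: hlogD_int; last exact: hlog_pair_int.
by have [m hm] := ha; exists m; rewrite hlog_shift hlog_sigma.
Qed.

End SigmaPair.

Lemma sigma_screening a a' N c b p : a != a' -> N = cpl k a a' + 1 ->
  (exists m : int, zeromode k c b = m%:~R) ->
  (exists m : int, zeromode k c (b + field_mom (pairfield a a' N 1)) = m%:~R) ->
  integral_pair a a' N b -> integral_pair a a' N (b + field_mom (sig c)) ->
  normexp (sig c) (b + field_mom (pairfield a a' N 1)) (- 1) (screening a a' N b p) +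
  screening a a' N (b + field_mom (sig c)) (normexp (sig c) b (- 1) p) = 0.
Proof.
move=> aa' hN hc hc' hb hb'; have N0 := proj1 (regular_level_cpl hq hgen aa' hN).
have [ca|ca] := eqVneq c a.
  by rewrite ca in hc hc' hb' *; exact: sigma_screening_pole.
have [ca'|ca'] := eqVneq c a'; last exact: sigma_screening_regular.
rewrite ca' in hc hc' hb' *.
have h1 := integral_pairC hb; have h2 := integral_pairC hb'.
rewrite -(mom_swap a a' N 1) in hc' *.
have a'a : a' != a by rewrite eq_sym.
have hN' : N = cpl k a' a + 1 by rewrite cplC.
apply: etrans (congr2 +%R (congr1 _ (screening_swap p N0 h1)) (screening_swap _ N0 h2)) _.
apply: etrans (linear_opp_add _ _ (normexp_sigma_linear hc')) _.
have h := sigma_screening_pole a'a hN' p hc hc' h1.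
apply: etrans (congr1 -%R h) _; exact: oppr0.
Qed.

(** The residues for e = 1 and e = -1 are opposite, and the exponentials that
    they multiply agree up to a shift. *)
Lemma screening_aligned a c c' N M b p : a != c -> a != c' -> c != c' ->
  N = cpl k a c + 1 -> M = cpl k c c' + 1 ->
  integral_pair a c N b -> integral_pair c c' M b ->
  integral_pair a c N (b + field_mom (pairfield c c' M 1)) ->
  integral_pair c c' M (b + field_mom (pairfield a c N 1)) ->
  screening a c N (b + field_mom (pairfield c c' M 1)) (screening c c' M b p) =
  screening c c' M (b + field_mom (pairfield a c N 1)) (screening a c N b p).
Proof.
move=> ac ac' cc' hN hM hX hY hX' hY'.
have goodN := regular_level_cpl hq hgen ac hN; have goodM := regular_level_cpl hq hgen cc' hM.
have N0 := proj1 goodN; have M0 := proj1 goodM.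
have linX e := linear_scaleB _ _ _ (normexp_pair_linear e N0 hX').
have linY e := linear_scaleB _ _ _ (normexp_pair_linear e M0 hY').
apply: etrans (screeningE _ _ _ _ _) _; apply: esym; apply: etrans (screeningE _ _ _ _ _) _.
apply: etrans (congr2 (fun u v => _ *: (u - v))
  (etrans (congr1 _ (screeningE a c N b p)) (linY _ _ _ _))
  (etrans (congr1 _ (screeningE a c N b p)) (linY _ _ _ _))) _.
apply: esym; apply: etrans (congr2 (fun u v => _ *: (u - v))
  (etrans (congr1 _ (screeningE c c' M b p)) (linX _ _ _ _))
  (etrans (congr1 _ (screeningE c c' M b p)) (linX _ _ _ _))) _.
have p1 : is_sign (1 : K) by left.
have m1 : is_sign (-1 : K) by right.
apply: (@scaleB_sub _ _ _ (qpow lq (- 1) - qpow lq 1) _ _ _ _ _ _ _ _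
  (normexp (fieldD (shiftf (- 1 * M) (pairfield a c N 1)) (pairfield c c' M 1)) b 0 p)).
- exact: (pair_pair_pole hq hk hgen ac ac' cc' hN hM p p1 hX hY).
- apply: etrans (pair_pair_pole hq hk hgen ac ac' cc' hN hM p m1 hX hY) _.
  rewrite opprK opprB; apply: (congr1 ( *:%R _)).
  rewrite -[X in shiftf (X * M)]opprK.
  rewrite (pair_pair_shift hq ac ac' cc' N0 M0 (proj2 goodN) (proj2 goodM)).
  by apply: normexp_shift0; apply: hlogD_int; [rewrite hlog_shift|]; exact: hlog_pair_int.
- exact: (pair_pair_regular hq hk hgen ac ac' cc' hN hM p p1 hX hY).
have := pair_pair_regular hq hk hgen ac ac' cc' hN hM p m1 hX hY.
by rewrite opprK.
Qed.

End Operators.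

Section Commute.
Variables (R : realType) (lq : R[i]) (k : 'I_3 -> R[i]).
Local Notation K := (R[i]).
Implicit Types (a c : 'I_4) (b : momentum R) (N M : K).
Hypothesis hq : `|cexp lq| < 1.
Hypothesis hk : \sum_(i < 3) k i = - 4%:R.
Hypothesis hgen : generic lq k.
Local Notation pairfield := (pair_field lq).
Local Notation normexp := (normexp lq k).
Local Notation integral_pair := (integral_charge k).
Local Notation scr := (screening lq k).

Lemma screening_opp a a' N b p : N != 0 -> integral_pair a a' N b ->
  scr a a' N b (- p) = - scr a a' N b p.
Proof.
move=> N0 hb.
have h e : normexp (pairfield a a' N e) b 0 (- p) = - normexp (pairfield a a' N e) b 0 p.
  have [L ->] := linear_pack (normexp_pair_linear hq e N0 hb); exact: linearN.
apply: etrans (screeningE _ _ _ _ _ _ _) _.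
apply: etrans (congr2 (fun u v => _ *: (u - v)) (h 1) (h (- 1))) _.
apply: esym; apply: etrans (congr1 -%R (screeningE _ _ _ _ _ _ _)) _.
by apply: etrans (scaleB_opp _ _ _) _; apply: (congr1 ( *:%R _)); rewrite opprK addrC.
Qed.

Lemma screening0 a a' N b : scr a a' N b 0 = 0.
Proof.
apply: etrans (screeningE _ _ _ _ _ _ _) _.
apply: etrans (congr2 (fun u v => _ *: (u - v)) (normexp0 _ _ _ _ _) (normexp0 _ _ _ _ _)) _.
by rewrite subr0 scaler0.
Qed.

Definition screening_commute a a' N c c' M := forall b p,
  integral_pair a a' N b -> integral_pair c c' M b ->
  integral_pair a a' N (b + field_mom (pairfield c c' M 1)) ->
  integral_pair c c' M (b + field_mom (pairfield a a' N 1)) ->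
  scr a a' N (b + field_mom (pairfield c c' M 1)) (scr c c' M b p) =
  scr c c' M (b + field_mom (pairfield a a' N 1)) (scr a a' N b p).

Lemma screening_commute_sym a a' N c c' M :
  screening_commute a a' N c c' M -> screening_commute c c' M a a' N.
Proof. by move=> h b p h1 h2 h3 h4; apply: esym; apply: h. Qed.

Lemma screening_commute_swap a a' N c c' M : N != 0 -> M != 0 ->
  screening_commute a a' N c c' M -> screening_commute a' a N c c' M.
Proof.
move=> N0 M0 h b p /integral_pairC h1 h2 /integral_pairC h3.
rewrite (mom_swap hq a a' N 1) => h4.
apply: etrans (screening_swap hq _ N0 h3) _; apply: esym.
apply: etrans (congr1 _ (screening_swap hq p N0 h1)) _.
apply: etrans (screening_opp _ M0 h4) _.
by apply: (congr1 -%R); apply: esym; apply: h.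
Qed.

(** The four positions of the common boson reduce to [screening_aligned] by
    exchanging the entries of the pairs. *)
Lemma screening_commute_share a a' c c' N M : a != a' -> c != c' ->
  N = cpl k a a' + 1 -> M = cpl k c c' + 1 ->
  [|| (a' == c) && (a != c'), (a' == c') && (a != c), (a == c) && (a' != c') |
      (a == c') && (a' != c)] ->
  screening_commute a a' N c c' M.
Proof.
move=> aa' cc' hN hM.
have N0 := proj1 (regular_level_cpl hq hgen aa' hN);
  have M0 := proj1 (regular_level_cpl hq hgen cc' hM).
have a'a : a' != a by rewrite eq_sym.
have c'c : c' != c by rewrite eq_sym.
have hN' : N = cpl k a' a + 1 by rewrite cplC.
have hM' : M = cpl k c' c + 1 by rewrite cplC.
case/or4P => /andP[/eqP h1 h2].
- move: hM cc'; rewrite -h1 => hM cc' b p; exact: screening_aligned.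
- apply: screening_commute_sym; apply: (screening_commute_swap M0 N0);
  apply: screening_commute_sym.
  move: hM' c'c; rewrite -h1 => hM' c'c b p; exact: screening_aligned.
- apply: (screening_commute_swap N0 M0).
  move: hM cc'; rewrite -h1 => hM cc' b p; exact: screening_aligned.
apply: (screening_commute_swap N0 M0).
apply: screening_commute_sym; apply: (screening_commute_swap M0 N0); apply: screening_commute_sym.
move: hM' c'c; rewrite -h1 => hM' c'c b p; exact: screening_aligned.
Qed.

End Commute.

(** * Operators on the direct sum of the sectors *)

Section Sectors.
Variables (V : zmodType) (T : choiceType).

Lemma sum_sector (f : T -> V -> V) (g : T -> T) (p : V) (b : T) : f b 0 = 0 ->
  \sum_(c <- msupp << p *g b >>) << f c (<< p *g b >>)@_c *g g c >> =
  << f b p *g g b >>.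
Proof.
move=> f0; have [->|p0] := eqVneq p 0.
  by rewrite monalgU0 msupp0 big_seq_fset0 f0 monalgU0.
by rewrite msuppU (negbTE p0) big_seq_fset1 mcoeffUU.
Qed.

End Sectors.

Section Final.
Variable R : realType.

Lemma op_app_sector (A : operator R) p b : op_act A b 0 = 0 ->
  op_app A << p *g b >> = << op_act A b p *g b + op_mom A >>.
Proof. exact: sum_sector. Qed.

Lemma commute_from_act (A B : operator R) :
  (forall b, op_act A b 0 = 0) -> (forall b, op_act B b 0 = 0) ->
  (forall b p, op_dom A b -> op_dom B b -> op_dom A (b + op_mom B) ->
     op_dom B (b + op_mom A) ->
     op_act A (b + op_mom B) (op_act B b p) = op_act B (b + op_mom A) (op_act A b p)) ->
  commute_on_sectors A B.
Proof.
move=> A0 B0 h b [hB hA'] [hA hB'] v [p ->].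
have eB : op_app B << p *g b >> = << op_act B b p *g b + op_mom B >>.
  exact: op_app_sector.
have eA : op_app A << p *g b >> = << op_act A b p *g b + op_mom A >>.
  exact: op_app_sector.
apply: etrans (congr2 (fun u w => op_app A u - op_app B w) eB eA) _.
apply: etrans (congr2 (fun u w => u - w) (op_app_sector _ (A0 _)) (op_app_sector _ (B0 _))) _.
rewrite (h b p hA hB hA' hB') [b + op_mom B + _]addrAC; exact: subrr.
Qed.

Lemma anticommute_from_act (A B : operator R) :
  (forall b, op_act A b 0 = 0) -> (forall b, op_act B b 0 = 0) ->
  (forall b p, op_dom A b -> op_dom B b -> op_dom A (b + op_mom B) ->
     op_dom B (b + op_mom A) ->
     op_act A (b + op_mom B) (op_act B b p) + op_act B (b + op_mom A) (op_act A b p) = 0) ->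
  anticommute_on_sectors A B.
Proof.
move=> A0 B0 h b [hB hA'] [hA hB'] v [p ->].
have eB : op_app B << p *g b >> = << op_act B b p *g b + op_mom B >>.
  exact: op_app_sector.
have eA : op_app A << p *g b >> = << op_act A b p *g b + op_mom A >>.
  exact: op_app_sector.
apply: etrans (congr2 (fun u w => op_app A u + op_app B w) eB eA) _.
apply: etrans (congr2 (fun u w => u + w) (op_app_sector _ (A0 _)) (op_app_sector _ (B0 _))) _.
rewrite [b + op_mom B + _]addrAC; apply: etrans (esym (monalgUD _ _ _)) _.
apply: etrans (congr1 (mkmalgU _) (h b p hA hB hA' hB')) _; exact: monalgU0.
Qed.

End Final.

Section Main.
Variables (R : realType) (q lq : R[i]) (k : 'I_3 -> R[i]).
Hypothesis hq1 : `|q| < 1.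
Hypothesis hlq : cexp lq = q.
Hypothesis hk : \sum_(i < 3) k i = - 4%:R.
Hypothesis hgen : generic lq k.

Let hq : `|cexp lq| < 1. Proof. by rewrite hlq. Qed.

Lemma rho_labels (j : 'I_3) : (bos (j + 1) != bos (j + 2%:R)) &&
  (k j + 2%:R == cpl k (bos (j + 1)) (bos (j + 2%:R)) + 1).
Proof.
have n12 : j + 1 != j + 2%:R by case: j => -[|[|[|//]]].
have n1 : j + 1 != j by case: j {n12} => -[|[|[|//]]].
have n2 : j + 2%:R != j by case: j {n12 n1} => -[|[|[|//]]].
rewrite bos_neq n12 /cpl !liftK (negbTE n12) (third_label n12 n1 n2) /=.
by apply/eqP; ring.
Qed.

Lemma tau_labels (j : 'I_3) : (ord0 != bos j) && (k j + 2%:R == cpl k ord0 (bos j) + 1).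
Proof. by rewrite bos_neq0 /cpl unlift_none liftK /=; apply/eqP; ring. Qed.

(** The operator identity a_{0,0} + a_{1,0} + a_{2,0} + a_{3,0} = 0. *)
Lemma sum_zeromode b : \sum_(i < 4) zeromode k i b = 0.
Proof.
rewrite exchange_big big1 //= => j _; rewrite -mulr_sumr.
rewrite (eq_bigr (fun i => cpl k (bos j) i)); last by move=> i _; rewrite cplC.
by rewrite big_ord_recl -(cpl_row0 hk) addNr mulr0.
Qed.

(** The domain of tau_j is stated with the two bosons outside the pair {a_0,
    a_j}; their zero modes add up to the opposite of those of the pair. *)
Lemma tau_dom j b : op_dom (tau lq k j) b ->
  integral_charge k ord0 (bos j) (k j + 2%:R) b.
Proof.
move=> [m hm]; exists (- m); rewrite rmorphN mulrN -hm.
have := sum_zeromode b; rewrite big_ord_recl.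
have n1 : j + 1 != j by case: j {hm} => -[|[|[|//]]].
have n2 : j + 2%:R != j by case: j {n1 hm} => -[|[|[|//]]].
have n12 : j + 2%:R != j + 1 by case: j {n1 n2 hm} => -[|[|[|//]]].
rewrite (bigD1 j) //= (bigD1 (j + 1)) //= (bigD1 (j + 2%:R)) /= ?n2 ?n12 //.
rewrite big1 ?addr0; last first.
  move=> i /andP[/andP[h1 h2] h3]; exfalso; move: h1 h2 h3.
  by case: j i {n1 n2 n12 hm} => -[|[|[|//]]] ? [[|[|[|//]]] ?].
move=> h; apply/eqP; rewrite -subr_eq0 opprK; apply/eqP.
by apply: etrans h; rewrite -!addrA.
Qed.

Lemma sigma_anticommutes i a a' N (B : operator R) :
  a != a' -> N = cpl k a a' + 1 ->
  op_mom B = field_mom (pair_field lq a a' N 1) ->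
  (forall b p, op_act B b p = screening lq k a a' N b p) ->
  (forall b, op_dom B b -> integral_charge k a a' N b) ->
  anticommute_on_sectors (sigma lq k i) B.
Proof.
move=> aa' hN mB aB dB; apply: anticommute_from_act.
- by move=> b; exact: normexp0.
- by move=> b; apply: etrans (aB _ _) _; exact: screening0.
move=> b p hA hB hA' hB'.
rewrite !aB mB /= (boson_bosonN hq i).
rewrite mB in hA'; rewrite /= (boson_bosonN hq i) in hB'.
exact: (sigma_screening hq hk hgen p aa' hN hA hA' (dB _ hB) (dB _ hB')).
Qed.

Lemma bosonic_commute a a' c c' N M (A B : operator R) :
  a != a' -> c != c' -> N = cpl k a a' + 1 -> M = cpl k c c' + 1 ->
  [|| (a' == c) && (a != c'), (a' == c') && (a != c), (a == c) && (a' != c') |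
      (a == c') && (a' != c)] ->
  op_mom A = field_mom (pair_field lq a a' N 1) ->
  (forall b p, op_act A b p = screening lq k a a' N b p) ->
  (forall b, op_dom A b -> integral_charge k a a' N b) ->
  op_mom B = field_mom (pair_field lq c c' M 1) ->
  (forall b p, op_act B b p = screening lq k c c' M b p) ->
  (forall b, op_dom B b -> integral_charge k c c' M b) ->
  commute_on_sectors A B.
Proof.
move=> aa' cc' hN hM hs mA aA dA mB aB dB; apply: commute_from_act.
- by move=> b; apply: etrans (aA _ _) _; exact: screening0.
- by move=> b; apply: etrans (aB _ _) _; exact: screening0.
move=> b p hA hB hA' hB'; rewrite !aA !aB mA mB.
rewrite mB in hA'; rewrite mA in hB'.
exact: (screening_commute_share hq hk hgen aa' cc' hN hM hs p (dA _ hA) (dB _ hB) (dA _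
  hA') (dB _ hB')).
Qed.

End Main.

Theorem proposition3p1 (R : realType) (q lq : R[i]) (k : 'I_3 -> R[i])
    (hq0 : q != 0) (hq1 : `|q| < 1) (hlq : cexp lq = q)
    (hk : \sum_(i < 3) k i = - 4%:R) (hgen : generic lq k) :
  (forall (i : 'I_4) (j : 'I_3),
     anticommute_on_sectors (sigma lq k i) (rho lq k j) /\
     anticommute_on_sectors (sigma lq k i) (tau lq k j)) /\
  (forall i j : 'I_3, i != j ->
     [/\ commute_on_sectors (rho lq k i) (rho lq k j),
         commute_on_sectors (rho lq k i) (tau lq k j) &
         commute_on_sectors (tau lq k i) (tau lq k j)]).
Proof.
split=> [i j|i j ij].
  have /andP[r1 /eqP r2] := rho_labels k j; have /andP[t1 /eqP t2] := tau_labels k j.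
  split.
    apply: (sigma_anticommutes hq1 hlq hk hgen r1 r2) => // b.
  by apply: (sigma_anticommutes hq1 hlq hk hgen t1 t2) => // b; exact: tau_dom.
have /andP[ri1 /eqP ri2] := rho_labels k i; have /andP[ti1 /eqP ti2] := tau_labels k i.
have /andP[rj1 /eqP rj2] := rho_labels k j; have /andP[tj1 /eqP tj2] := tau_labels k j.
have sh1 : [|| (i + 2%:R == j + 1) && (i + 1 != j + 2%:R),
    (i + 2%:R == j + 2%:R) && (i + 1 != j + 1),
    (i + 1 == j + 1) && (i + 2%:R != j + 2%:R) | (i + 1 == j + 2%:R) && (i + 2%:R != j + 1)].
  by move: ij; case: i j {ri1 ri2 ti1 ti2 rj1 rj2 tj1 tj2} => -[|[|[|//]]] ? [[|[|[|//]]] ?].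
have sh2 : (i + 2%:R == j) || (i + 1 == j).
  by move: ij; case: i j {ri1 ri2 ti1 ti2 rj1 rj2 tj1 tj2 sh1} => -[|[|[|//]]] ? [[|[|[|//]]] ?].
split.
- apply: (bosonic_commute hq1 hlq hk hgen ri1 rj1 ri2 rj2) => //.
- apply: (bosonic_commute hq1 hlq hk hgen ri1 tj1 ri2 tj2) => //; last first.
    by move=> b; exact: tau_dom.
  rewrite !bos_neq ![bos _ == ord0]eq_sym !bos_neq0 /=.
  by case/orP: sh2 => ->; rewrite ?orbT.
apply: (bosonic_commute hq1 hlq hk hgen ti1 tj1 ti2 tj2) => //.
- by rewrite !bos_neq ij eqxx /= !orbT.
- by move=> b; exact: tau_dom.
by move=> b; exact: tau_dom.
Qed.
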